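(* Let $\mathcal{H}$ be a complex Hilbert space and let $A\in\mathcal{B}(\mathcal{H})$. Then for all $\alpha\in[0,1]$, $$w^2(A)\le\left\|\int_0^1\left((1-t)\left(\alpha\left(\frac{|A|+|A^*|}{2}\right)^2+(1-\alpha)|A^*|^2\right)+t\,w^2(A)I\right)^2dt\right\|^{1/2}\le\left\|\alpha\left(\frac{|A|+|A^*|}{2}\right)^2+(1-\alpha)|A^*|^2\right\|.$$
   Context: $\mathcal{B}(\mathcal{H})$ is the set of bounded linear operators on $\mathcal{H}$, $A^*$ is the adjoint of $A$, $|A|=(A^*A)^{1/2}$, $I$ is the identity operator, and $\|\cdot\|$ is the operator norm. The numerical radius is $w(A)=\sup\{|\langle Ax,x\rangle| : x\in\mathcal{H},\ \|x\|=1\}$, and $w^2(A)=(w(A))^2$. The integral is the integral over $[0,1]$ of a norm-continuous operator-valued function. *)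

(* Defs.v *)
From Stdlib Require Export Reals.
From Stdlib Require Import Lra Classical ClassicalEpsilon FunctionalExtensionality.
From Stdlib Require Import PropExtensionality.
From Coquelicot Require Export Coquelicot.
Open Scope R_scope.

(** Complex Hilbert spaces: complete complex normed modules whose norm comes
    from an inner product, linear in its first argument.  Definiteness of
    [inner] follows from [hilbert_norm] and definiteness of [norm]. *)
Record HilbertSpace := {
  hilbert_space :> CompleteNormedModule C_AbsRing;
  inner : hilbert_space -> hilbert_space -> C;
  inner_plus_l : forall x y z : hilbert_space,
    inner (plus x y) z = (inner x z + inner y z)%C;
  inner_scal_l : forall (a : C) (x y : hilbert_space),
    inner (scal (a : C_AbsRing) x) y = (a * inner x y)%C;
  inner_conj : forall x y : hilbert_space, inner y x = Cconj (inner x y);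
  hilbert_norm : forall x : hilbert_space, inner x x = RtoC (norm x ^ 2)
}.
Arguments inner {h} x y.

(** Coquelicot's [is_linear] already includes boundedness. *)
Record BOp (H : HilbertSpace) := {
  op_fun :> H -> H;
  op_linear : @is_linear C_AbsRing H H op_fun
}.
Arguments op_fun {H} _ _.
Arguments op_linear {H} _.

(** [Lub_Rbar] of the empty set is [m_infty], which [real] sends to 0; hence
    [numerical_radius] is 0 on the zero space. *)
Definition sup (E : R -> Prop) : R := real (Lub_Rbar E).

Definition op_norm {H : HilbertSpace} (A : BOp H) : R :=
  sup (fun r => exists x : H, norm x <= 1 /\ r = norm (A x)).

Definition numerical_radius {H : HilbertSpace} (A : BOp H) : R :=
  sup (fun r => exists x : H, norm x = 1 /\ r = Cmod (inner (A x) x)).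

Lemma sup_ub (E : R -> Prop) (M r : R) :
  (forall s, E s -> s <= M) -> E r -> r <= sup E.
Proof.
intros HM Hr. unfold sup.
destruct (Lub_Rbar_correct E) as [Hub Hl].
assert (H1 := Hub r Hr).
assert (H2 : Rbar_le (Lub_Rbar E) M) by (apply Hl; intros s Hs; exact (HM s Hs)).
destruct (Lub_Rbar E); simpl in *; easy.
Qed.

Lemma sup_le (E : R -> Prop) (M : R) :
  (exists s, E s) -> (forall s, E s -> s <= M) -> sup E <= M.
Proof.
intros [r Hr] HM. unfold sup.
destruct (Lub_Rbar_correct E) as [Hub Hl].
assert (H1 := Hub r Hr).
assert (H2 : Rbar_le (Lub_Rbar E) M) by (apply Hl; intros s Hs; exact (HM s Hs)).
destruct (Lub_Rbar E); simpl in *; easy.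
Qed.

Lemma plus_minus_plus_group {G : AbelianGroup} (a b c d : G) :
  plus (minus a c) (minus b d) = minus (plus a b) (plus c d).
Proof.
unfold minus. rewrite opp_plus, <- !plus_assoc. f_equal.
rewrite !plus_assoc. f_equal. apply plus_comm.
Qed.

Lemma minus_plus_cancel_group {G : AbelianGroup} (a b : G) :
  plus (minus a b) b = a.
Proof. unfold minus. now rewrite <- plus_assoc, plus_opp_l, plus_zero_r. Qed.

Section Operators.
Context {H : HilbertSpace}.
Implicit Types (A B : BOp H) (x y : H).

Lemma op_ext A B : (forall x, A x = B x) -> A = B.
Proof.
destruct A as [f hf], B as [g hg]; simpl; intros E.
assert (f = g) by (apply functional_extensionality; exact E).
subst g. f_equal. apply proof_irrelevance.
Qed.

Lemma abs_RtoC (a : R) : abs (RtoC a : C_AbsRing) = Rabs a.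
Proof. exact (Cmod_R a). Qed.

Lemma norm_scal_RtoC (a : R) x :
  norm (scal (RtoC a : C_AbsRing) x) <= Rabs a * norm x.
Proof. rewrite <- abs_RtoC. exact (norm_scal (RtoC a : C_AbsRing) x). Qed.

Lemma norm_plus_le x y : norm (plus x y) <= norm x + norm y.
Proof. exact (@norm_triangle C_AbsRing H x y). Qed.

Lemma norm_0 : norm (zero : H) = 0.
Proof. exact (@norm_zero C_AbsRing H). Qed.

Lemma norm_eq_0 x : norm x = 0 -> x = zero.
Proof. exact (@norm_eq_zero C_AbsRing H x). Qed.

Lemma op_0 A : A zero = zero.
Proof. exact (@linear_zero C_AbsRing H H A (op_linear A)). Qed.

Lemma op_add A x y : A (plus x y) = plus (A x) (A y).
Proof. exact (@linear_plus C_AbsRing H H A (op_linear A) x y). Qed.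

Lemma op_smul A (k : C_AbsRing) x : A (scal k x) = scal k (A x).
Proof. exact (@linear_scal C_AbsRing H H A (op_linear A) k x). Qed.

Lemma op_zero_linear : @is_linear C_AbsRing H H (fun _ : H => zero : H).
Proof. exact (@is_linear_zero C_AbsRing H H). Qed.

Lemma op_id_linear : @is_linear C_AbsRing H H (fun x : H => x).
Proof. exact (@is_linear_id C_AbsRing H). Qed.

Lemma op_comp_linear A B : @is_linear C_AbsRing H H (fun x : H => A (B x)).
Proof. exact (@is_linear_comp C_AbsRing H H H B A (op_linear B) (op_linear A)). Qed.

Lemma op_plus_linear A B : @is_linear C_AbsRing H H (fun x : H => plus (A x) (B x)).
Proof.
destruct (op_linear A) as [Ap As [M [HM An]]].
destruct (op_linear B) as [Bp Bs [N [HN Bn]]].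
split.
- intros x y. rewrite Ap, Bp.
  rewrite <- !plus_assoc. f_equal.
  rewrite !plus_assoc. f_equal. apply plus_comm.
- intros k x. rewrite As, Bs. symmetry. exact (scal_distr_l k (A x) (B x)).
- exists (M + N). split. lra. intros x.
  apply Rle_trans with (1 := norm_plus_le _ _).
  rewrite Rmult_plus_distr_r. apply Rplus_le_compat; auto.
Qed.

Lemma op_scal_linear (a : R) A :
  @is_linear C_AbsRing H H (fun x : H => scal (RtoC a : C_AbsRing) (A x)).
Proof.
destruct (op_linear A) as [Ap As [M [HM An]]].
split.
- intros x y. rewrite Ap. exact (scal_distr_l (RtoC a : C_AbsRing) (A x) (A y)).
- intros k x. rewrite As, !scal_assoc. f_equal. apply Cmult_comm.
- exists (Rabs a * M + 1). assert (Ha := Rabs_pos a). split.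
  assert (0 <= Rabs a * M) by (apply Rmult_le_pos; lra). lra.
  intros x. apply Rle_trans with (1 := norm_scal_RtoC _ _).
  assert (Hx := norm_ge_0 x).
  assert (Rabs a * norm (A x) <= Rabs a * (M * norm x))
    by (apply Rmult_le_compat_l; auto).
  lra.
Qed.

Definition op_zero : BOp H := Build_BOp H _ op_zero_linear.
Definition op_id : BOp H := Build_BOp H _ op_id_linear.
Definition op_comp A B : BOp H := Build_BOp H _ (op_comp_linear A B).
Definition op_plus A B : BOp H := Build_BOp H _ (op_plus_linear A B).
Definition op_scal (a : R) A : BOp H := Build_BOp H _ (op_scal_linear a A).
Definition op_opp A : BOp H := op_scal (-1) A.

Lemma op_norm_ub A x : norm x <= 1 -> norm (A x) <= op_norm A.
Proof.
intros Hx. destruct (linear_norm _ (op_linear A)) as [M [HM An]].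
apply sup_ub with M.
- intros s [z [Hz ->]]. apply Rle_trans with (1 := An z).
  rewrite <- (Rmult_1_r M) at 2. apply Rmult_le_compat_l; lra.
- now exists x.
Qed.

Lemma op_norm_le A M : (forall x, norm x <= 1 -> norm (A x) <= M) -> op_norm A <= M.
Proof.
intros HM. apply sup_le.
- exists (norm (A zero)), zero. split; auto. rewrite norm_0. lra.
- intros s [x [Hx ->]]. auto.
Qed.

Lemma op_norm_ge0 A : 0 <= op_norm A.
Proof.
apply Rle_trans with (norm (A zero)). apply norm_ge_0.
apply op_norm_ub. rewrite norm_0. lra.
Qed.

Lemma op_norm_apply A x : norm (A x) <= op_norm A * norm x.
Proof.
destruct (Req_dec (norm x) 0) as [E|E].
- rewrite (norm_eq_0 _ E), op_0, norm_0; try lra.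
- assert (Hx : 0 < norm x) by (assert (Hx := norm_ge_0 x); lra).
  set (u := scal (RtoC (/ norm x) : C_AbsRing) x).
  assert (Hu : norm u <= 1).
  { apply Rle_trans with (1 := norm_scal_RtoC _ _).
    rewrite Rabs_pos_eq. right; field; lra. left; apply Rinv_0_lt_compat; lra. }
  assert (Ex : x = scal (RtoC (norm x) : C_AbsRing) u).
  { unfold u. rewrite scal_assoc. rewrite <- (scal_one x) at 1. f_equal.
    unfold mult; simpl. rewrite <- RtoC_mult, Rinv_r; auto. }
  rewrite Ex at 1. rewrite op_smul.
  apply Rle_trans with (1 := norm_scal_RtoC _ _).
  rewrite Rabs_pos_eq by lra. rewrite Rmult_comm.
  apply Rmult_le_compat_r. lra. now apply op_norm_ub.
Qed.

Lemma op_norm_triangle A B : op_norm (op_plus A B) <= op_norm A + op_norm B.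
Proof.
apply op_norm_le; intros x Hx; simpl.
apply Rle_trans with (1 := norm_plus_le _ _).
apply Rplus_le_compat; now apply op_norm_ub.
Qed.

Lemma op_norm_scal (a : R) A : op_norm (op_scal a A) <= Rabs a * op_norm A.
Proof.
apply op_norm_le; intros x Hx; simpl.
apply Rle_trans with (1 := norm_scal_RtoC _ _).
apply Rmult_le_compat_l. apply Rabs_pos. now apply op_norm_ub.
Qed.

Lemma op_norm_eq0 A : op_norm A = 0 -> A = op_zero.
Proof.
intros E. apply op_ext; intros x; simpl. apply norm_eq_0.
assert (Hx := op_norm_apply A x). rewrite E in Hx.
assert (H0 := norm_ge_0 (A x)). lra.
Qed.

Lemma op_plus_comm A B : op_plus A B = op_plus B A.
Proof. apply op_ext; intros x. exact (plus_comm (A x) (B x)). Qed.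

Lemma op_plus_assoc A B (D : BOp H) :
  op_plus A (op_plus B D) = op_plus (op_plus A B) D.
Proof. apply op_ext; intros x. exact (plus_assoc (A x) (B x) (D x)). Qed.

Lemma op_plus_zero A : op_plus A op_zero = A.
Proof. apply op_ext; intros x. exact (plus_zero_r (A x)). Qed.

Lemma op_plus_opp A : op_plus A (op_opp A) = op_zero.
Proof.
apply op_ext; intros x; simpl.
replace (RtoC (-1)) with (opp (one : C_AbsRing)) by exact (eq_sym (RtoC_opp 1)).
transitivity (plus (A x) (opp (A x))); [f_equal | exact (plus_opp_r (A x))].
exact (scal_opp_one (K := C_AbsRing) (A x)).
Qed.

Lemma op_scal_assoc (a b : R) A : op_scal a (op_scal b A) = op_scal (a * b) A.
Proof.
apply op_ext; intros x; simpl. rewrite RtoC_mult.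
exact (scal_assoc (RtoC a : C_AbsRing) (RtoC b) (A x)).
Qed.

Lemma op_scal_one A : op_scal 1 A = A.
Proof. apply op_ext; intros x. exact (scal_one (A x)). Qed.

Lemma op_scal_distr_l (a : R) A B :
  op_scal a (op_plus A B) = op_plus (op_scal a A) (op_scal a B).
Proof.
apply op_ext; intros x. exact (scal_distr_l (RtoC a : C_AbsRing) (A x) (B x)).
Qed.

Lemma op_scal_distr_r (a b : R) A :
  op_scal (a + b) A = op_plus (op_scal a A) (op_scal b A).
Proof.
apply op_ext; intros x; simpl. rewrite RtoC_plus.
exact (scal_distr_r (RtoC a : C_AbsRing) (RtoC b) (A x)).
Qed.

Definition BOp_AbelianMonoid_mixin :=
  AbelianMonoid.Mixin (BOp H) op_plus op_zero op_plus_comm op_plus_assoc op_plus_zero.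
Canonical BOp_AbelianMonoid :=
  AbelianMonoid.Pack (BOp H) BOp_AbelianMonoid_mixin (BOp H).

Definition BOp_AbelianGroup_mixin :=
  AbelianGroup.Mixin BOp_AbelianMonoid op_opp op_plus_opp.
Canonical BOp_AbelianGroup :=
  AbelianGroup.Pack (BOp H)
    (AbelianGroup.Class _ _ BOp_AbelianGroup_mixin) (BOp H).

Definition BOp_ModuleSpace_mixin :=
  ModuleSpace.Mixin R_Ring BOp_AbelianGroup op_scal
    op_scal_assoc op_scal_one op_scal_distr_l op_scal_distr_r.
Canonical BOp_ModuleSpace :=
  ModuleSpace.Pack R_Ring (BOp H)
    (ModuleSpace.Class _ _ _ BOp_ModuleSpace_mixin) (BOp H).

Definition op_ball A (e : R) B : Prop := op_norm (minus B A) < e.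

Lemma op_ball_center A (e : posreal) : op_ball A e A.
Proof.
unfold op_ball. rewrite minus_eq_zero.
apply Rle_lt_trans with 0; [|apply cond_pos].
apply op_norm_le; intros x _. simpl. rewrite norm_0. lra.
Qed.

Lemma op_ball_sym A B (e : R) : op_ball A e B -> op_ball B e A.
Proof.
unfold op_ball. intros h. apply Rle_lt_trans with (2 := h).
rewrite <- (opp_minus B A).
apply Rle_trans with (1 := op_norm_scal (-1) (minus B A)).
rewrite Rabs_m1. lra.
Qed.

Lemma op_ball_triangle A B (D : BOp H) (e1 e2 : R) :
  op_ball A e1 B -> op_ball B e2 D -> op_ball A (e1 + e2) D.
Proof.
unfold op_ball. intros h1 h2.
rewrite (minus_trans B D A).
assert (h := op_norm_triangle (minus D B) (minus B A)).
change (op_norm (plus (minus D B) (minus B A)) <=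
  op_norm (minus D B) + op_norm (minus B A)) in h.
lra.
Qed.

Definition BOp_UniformSpace_mixin :=
  UniformSpace.Mixin (BOp H) op_zero op_ball
    op_ball_center op_ball_sym op_ball_triangle.
Canonical BOp_UniformSpace :=
  UniformSpace.Pack (BOp H) BOp_UniformSpace_mixin (BOp H).

Canonical BOp_NormedModuleAux :=
  NormedModuleAux.Pack R_AbsRing (BOp H)
    (NormedModuleAux.Class R_AbsRing (BOp H)
      (ModuleSpace.class R_Ring BOp_ModuleSpace) BOp_UniformSpace_mixin) (BOp H).

Lemma op_norm_compat1 A B (e : R) : op_norm (minus B A) < e -> ball A e B.
Proof. easy. Qed.

Lemma op_norm_compat2 A B (e : posreal) : ball A e B -> op_norm (minus B A) < 1 * e.
Proof. now rewrite Rmult_1_l. Qed.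

Definition BOp_NormedModule_mixin :=
  NormedModule.Mixin R_AbsRing BOp_NormedModuleAux op_norm 1
    op_norm_triangle op_norm_scal op_norm_compat1 op_norm_compat2 op_norm_eq0.
Canonical BOp_NormedModule :=
  NormedModule.Pack R_AbsRing (BOp H)
    (NormedModule.Class R_AbsRing (BOp H) _ BOp_NormedModule_mixin) (BOp H).

Definition op_lim (F : (BOp H -> Prop) -> Prop) : BOp H :=
  epsilon (inhabits op_zero) (fun L => forall e : posreal, F (ball L e)).

Lemma op_minus_apply A B x : (minus A B) x = minus (A x) (B x).
Proof.
change (plus (A x) (op_opp B x) = plus (A x) (opp (B x))). f_equal. simpl.
replace (RtoC (-1)) with (opp (one : C_AbsRing)) by exact (eq_sym (RtoC_opp 1)).
exact (scal_opp_one (K := C_AbsRing) (B x)).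
Qed.

Lemma norm_minus_sym x y : norm (minus x y) = norm (minus y x).
Proof.
assert (E : forall u v : H, norm (minus u v) <= norm (minus v u)).
{ intros u v.
  replace (minus u v) with (scal (opp one : C_AbsRing) (minus v u)).
  - apply Rle_trans with (1 := norm_scal (K := C_AbsRing) (V := H) (opp one) (minus v u)).
    right. rewrite (abs_opp_one (K := C_AbsRing)). apply Rmult_1_l.
  - transitivity (opp (minus v u)).
    + exact (scal_opp_one (K := C_AbsRing) (minus v u)).
    + exact (opp_minus v u). }
apply Rle_antisym; apply E.
Qed.

Lemma norm_minus_plus_le x y (u v : H) :
  norm (minus (plus x y) (plus u v)) <= norm (minus x u) + norm (minus y v).
Proof.
apply Rle_trans with (2 := norm_plus_le (minus x u) (minus y v)).
right. f_equal. symmetry. exact (plus_minus_plus_group x y u v).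
Qed.

Lemma norm_minus_trans y x (z : H) :
  norm (minus x z) <= norm (minus x y) + norm (minus y z).
Proof.
apply Rle_trans with (2 := norm_plus_le (minus x y) (minus y z)).
right. f_equal. exact (minus_trans y x z).
Qed.

Lemma minus_plus_cancel x y : plus (minus x y) y = x.
Proof. exact (minus_plus_cancel_group x y). Qed.

Lemma scal_minus (k : C_AbsRing) x y :
  scal k (minus x y) = minus (scal k x) (scal k y).
Proof. exact (scal_minus_distr_l (K := C_AbsRing) k x y). Qed.

Lemma op_lim_pointwise (F : (BOp H -> Prop) -> Prop) :
  ProperFilter F -> cauchy F -> forall x, exists y,
    forall e, 0 < e -> F (fun T => norm (minus (T x) y) < e).
Proof.
intros FF Fc x.
pose (G := fun P : H -> Prop => F (fun T => P (T x))).
assert (GF : ProperFilter G) 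
  by exact (filtermap_proper_filter _ _ (fun T : BOp H => T x) F FF).
assert (Hx := norm_ge_0 (K := C_AbsRing) (x : H)).
assert (Gc : cauchy G).
{ intros e.
  assert (Hd : 0 < e / (norm x + 1)) by (apply Rdiv_lt_0_compat; [apply cond_pos|lra]).
  destruct (Fc (mkposreal _ Hd)) as [T0 HT0].
  exists (T0 x). unfold G. apply filter_imp with (2 := HT0). intros T HT.
  apply (norm_compat1 (K := C_AbsRing) (T0 x) (T x)).
  change (op_norm (minus T T0) < e / (norm x + 1)) in HT.
  apply Rle_lt_trans with (op_norm (minus T T0) * norm x).
  { rewrite <- op_minus_apply. apply op_norm_apply. }
  apply Rle_lt_trans with (e / (norm x + 1) * norm x).
  { apply Rmult_le_compat_r; lra. }
  apply Rlt_le_trans with (e / (norm x + 1) * (norm x + 1)).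
  { apply Rmult_lt_compat_l; lra. }
  right. field. lra. }
exists (lim (G : (CompleteNormedModule.CompleteSpace C_AbsRing H -> Prop) -> Prop)).
intros e He.
assert (Hf := norm_factor_gt_0 (K := C_AbsRing) (V := H)).
assert (Hd : 0 < e / @norm_factor C_AbsRing H) by now apply Rdiv_lt_0_compat.
assert (h := complete_cauchy
  (G : (CompleteNormedModule.CompleteSpace C_AbsRing H -> Prop) -> Prop)
  GF Gc (mkposreal _ Hd)).
unfold G in h at 1. apply filter_imp with (2 := h). intros T HT.
apply (norm_compat2 (K := C_AbsRing) (V := H)) in HT. simpl in HT.
apply Rlt_le_trans with (1 := HT). right. field. lra.
Qed.

Lemma op_lim_exists (F : (BOp H -> Prop) -> Prop) :
  ProperFilter F -> cauchy F -> exists L : BOp H, forall e : posreal, F (ball L e).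
Proof.
intros FF Fc.
destruct (choice _ (op_lim_pointwise F FF Fc)) as [l Hl].
assert (small : forall y z : H, (forall e, 0 < e -> norm (minus y z) < e) -> y = z).
{ intros y z Hz.
  assert (Hz0 := norm_ge_0 (K := C_AbsRing) (minus y z : H)).
  apply (eq_close (K := C_AbsRing) y z). intros e.
  apply (ball_sym (M := CompleteNormedModule.UniformSpace C_AbsRing H)).
  apply (norm_compat1 (K := C_AbsRing) z y). apply Hz, cond_pos. }
assert (Lp : forall x y, l (plus x y) = plus (l x) (l y)).
{ intros x y. apply small. intros e He.
  assert (He3 : 0 < e / 3) by lra.
  destruct (filter_ex _ (filter_and _ _ (Hl (plus x y) _ He3)
    (filter_and _ _ (Hl x _ He3) (Hl y _ He3)))) as [T [h1 [h2 h3]]].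
  rewrite op_add in h1.
  rewrite norm_minus_sym in h1.
  assert (h4 := norm_minus_plus_le (T x) (T y) (l x) (l y)).
  apply Rle_lt_trans with (1 := norm_minus_trans (plus (T x) (T y)) _ _). lra. }
assert (Ls : forall (k : C_AbsRing) x, l (scal k x) = scal k (l x)).
{ intros k x. apply small. intros e He.
  assert (Hk := abs_ge_0 k).
  assert (He2 : 0 < e / 2) by lra.
  assert (He3 : 0 < e / 2 / (abs k + 1)) by (apply Rdiv_lt_0_compat; lra).
  destruct (filter_ex _ (filter_and _ _ (Hl (scal k x) _ He2) (Hl x _ He3)))
    as [T [h1 h2]].
  rewrite op_smul in h1.
  rewrite norm_minus_sym in h1.
  apply Rle_lt_trans with (1 := norm_minus_trans (scal k (T x)) _ _).
  rewrite <- scal_minus.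
  assert (h4 := norm_scal (K := C_AbsRing) k (minus (T x) (l x) : H)).
  assert (h5 : abs k * norm (minus (T x) (l x)) <= (abs k + 1) * (e / 2 / (abs k + 1))).
  { apply Rmult_le_compat; try lra. apply (norm_ge_0 (K := C_AbsRing)). }
  replace ((abs k + 1) * (e / 2 / (abs k + 1))) with (e / 2) in h5 by (field; lra).
  change (norm (scal k (minus (T x) (l x))) <= abs k * norm (minus (T x) (l x))) in h4.
  lra. }
assert (Hsub : forall (T : BOp H) x, norm (T x) <= norm (minus (T x) (l x)) + norm (l x)
   /\ norm (l x) <= norm (minus (T x) (l x)) + norm (T x)).
{ intros T x.
  assert (E : forall u v : H, norm u <= norm (minus u v) + norm v).
  { intros u v. rewrite <- (minus_plus_cancel u v) at 1. apply norm_plus_le. }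
  split. apply E. rewrite norm_minus_sym. apply E. }
assert (Ln : exists M, 0 < M /\ forall x, norm (l x) <= M * norm x).
{ destruct (Fc (mkposreal 1 Rlt_0_1)) as [T0 HT0].
  assert (H0 := op_norm_ge0 T0).
  exists (op_norm T0 + 1). split; [lra|]. intros x.
  apply Rnot_lt_le; intros hlt.
  assert (He : 0 < norm (l x) - (op_norm T0 + 1) * norm x) by lra.
  destruct (filter_ex _ (filter_and _ _ HT0 (Hl x _ He))) as [T [h1 h2]].
  change (op_norm (minus T T0) < 1) in h1.
  assert (Hx := norm_ge_0 (K := C_AbsRing) (x : H)).
  assert (h3 : op_norm T <= op_norm T0 + 1).
  { apply op_norm_le. intros z Hz.
    assert (h4 := op_norm_ub (minus T T0) z Hz).
    assert (h5 := op_norm_ub T0 z Hz).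
    rewrite op_minus_apply in h4.
    assert (h6 := norm_plus_le (minus (T z) (T0 z)) (T0 z)).
    rewrite minus_plus_cancel in h6. lra. }
  assert (h4 := op_norm_apply T x).
  assert (h5 : op_norm T * norm x <= (op_norm T0 + 1) * norm x)
    by (apply Rmult_le_compat_r; assumption).
  destruct (Hsub T x). lra. }
exists (Build_BOp H l (Build_is_linear l Lp Ls Ln)).
intros e.
assert (He3 : 0 < e / 3) by (assert (He := cond_pos e); lra).
destruct (Fc (mkposreal _ He3)) as [T0 HT0].
apply filter_imp with (2 := HT0). intros T HT.
change (op_norm (minus T T0) < e / 3) in HT.
change (op_norm (minus T (Build_BOp H l (Build_is_linear l Lp Ls Ln))) < e).
apply Rle_lt_trans with (5 / 6 * e); [|assert (He := cond_pos e); lra].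
apply op_norm_le. intros x Hx. rewrite op_minus_apply. simpl.
assert (He6 : 0 < e / 6) by lra.
destruct (filter_ex _ (filter_and _ _ HT0 (Hl x _ He6))) as [T' [h1 h2]].
change (op_norm (minus T' T0) < e / 3) in h1.
assert (h3 := op_norm_ub (minus T T0) x Hx).
assert (h4 := op_norm_ub (minus T' T0) x Hx).
rewrite op_minus_apply in h3, h4.
rewrite norm_minus_sym in h4.
apply Rle_trans with (1 := norm_minus_trans (T0 x) _ _).
assert (h5 := norm_minus_trans (T' x) (T0 x) (l x)).
lra.
Qed.

Lemma op_lim_cauchy (F : (BOp H -> Prop) -> Prop) :
  ProperFilter F -> cauchy F -> forall e : posreal, F (ball (op_lim F) e).
Proof.
intros FF Fc. unfold op_lim. apply epsilon_spec. now apply op_lim_exists.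
Qed.

Lemma op_lim_close (F1 F2 : (BOp H -> Prop) -> Prop) :
  filter_le F1 F2 -> filter_le F2 F1 -> close (op_lim F1) (op_lim F2).
Proof.
intros h1 h2. replace F2 with F1. apply close_refl.
apply functional_extensionality; intros P. apply propositional_extensionality.
split; auto.
Qed.

Definition BOp_CompleteSpace_mixin :=
  CompleteSpace.Mixin BOp_UniformSpace op_lim op_lim_cauchy op_lim_close.
Canonical BOp_CompleteSpace :=
  CompleteSpace.Pack (BOp H)
    (CompleteSpace.Class (BOp H) _ BOp_CompleteSpace_mixin) (BOp H).

Canonical BOp_CompleteNormedModule :=
  CompleteNormedModule.Pack R_AbsRing (BOp H)
    (CompleteNormedModule.Class R_AbsRing (BOp H)
      (NormedModule.class R_AbsRing BOp_NormedModule) BOp_CompleteSpace_mixin) (BOp H).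

(** Adjoints and positive square roots exist and are unique, so the choices
    below pin down [adjoint A] for every [A], and [op_sqrt T] for every
    positive [T]. *)
Definition adjoint A : BOp H :=
  epsilon (inhabits op_zero) (fun B => forall x y, inner (A x) y = inner x (B y)).

Definition positive A : Prop :=
  forall x, 0 <= Re (inner (A x) x) /\ Im (inner (A x) x) = 0.

Definition op_sqr A : BOp H := op_comp A A.

Definition op_sqrt (T : BOp H) : BOp H :=
  epsilon (inhabits op_zero) (fun P => positive P /\ op_sqr P = T).

Definition op_abs A : BOp H := op_sqrt (op_comp (adjoint A) A).

End Operators.

(* Main.v *)
(** The chain rests on the pointwise bound [|<Ax,x>|^2 <= <Xx,x>] for unit [x],
    where [X] is the convex combination.  Its first summand is controlled by the
    mixed Schwarz inequality [|<Ax,y>|^2 <= <|A|x,x> <|A^*|y,y>] and AM-GM, its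
    second by [|<Ax,x>| <= |A^* x|].  With [m = w(A)^2] the integral equals
    [(X^2 + m X + m^2 I) / 3].  Evaluated at [x] it is at least
    [(c^2 + m c + m^2) / 3] with [c = |<Ax,x>|^2], and [c] approaches [m]; its
    norm is at most [|X|^2] because [m <= |X|].  Mixed Schwarz is the
    Cauchy-Schwarz inequality of the form [<|A^*|.,.>] on vectors [x] in the range of
    [|A|], by [A |A| = |A^*| A]; it extends to the closure of the range, whose
    orthogonal complement is killed by both [A] and [|A|]. *)

Require Import Defs.
From Stdlib Require Import Lra Lia Classical ClassicalEpsilon.

(** * Inner product algebra, positive forms and the Cauchy-Schwarz inequality *)

Section HilbertGeometry.
Context {H : HilbertSpace}.
Implicit Types x y z : H.

Lemma inner_plus_r x y z : inner x (plus y z) = (inner x y + inner x z)%C.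
Proof.
rewrite inner_conj, inner_plus_l, (inner_conj H y x), (inner_conj H z x).
apply Cplus_conj.
Qed.

Lemma inner_scal_r (a : C) x y :
  inner x (scal (a : C_AbsRing) y) = (Cconj a * inner x y)%C.
Proof.
rewrite inner_conj, inner_scal_l, Cmult_conj, <- inner_conj. reflexivity.
Qed.

Lemma inner_zero_l y : inner zero y = RtoC 0.
Proof.
assert (E : (zero : H) = scal (RtoC 0 : C_AbsRing) (zero : H))
  by exact (eq_sym (scal_zero_r (K := C_AbsRing) (V := H) (RtoC 0))).
rewrite E, inner_scal_l. apply Cmult_0_l.
Qed.

Lemma inner_zero_r y : inner y zero = RtoC 0.
Proof. rewrite inner_conj, inner_zero_l. unfold Cconj; simpl. now rewrite Ropp_0. Qed.

Lemma inner_opp_l x y : inner (opp x) y = (- inner x y)%C.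
Proof.
assert (E : opp x = scal (- RtoC 1 : C_AbsRing)%C x)
  by exact (eq_sym (scal_opp_one (K := C_AbsRing) (V := H) x)).
rewrite E, inner_scal_l. ring.
Qed.

Lemma inner_opp_r x y : inner x (opp y) = (- inner x y)%C.
Proof. now rewrite inner_conj, inner_opp_l, Copp_conj, <- inner_conj. Qed.

Lemma inner_minus_l x y z : inner (minus x y) z = (inner x z - inner y z)%C.
Proof. unfold minus. now rewrite inner_plus_l, inner_opp_l. Qed.

Lemma inner_minus_r x y z : inner z (minus x y) = (inner z x - inner z y)%C.
Proof. unfold minus. now rewrite inner_plus_r, inner_opp_r. Qed.

Lemma norm_sq x : norm x ^ 2 = Re (inner x x).
Proof. now rewrite hilbert_norm. Qed.

Lemma inner_self_zero x : inner x x = RtoC 0 -> x = zero.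
Proof.
intros E. apply norm_eq_0. assert (h := norm_sq x). rewrite E in h. simpl in h.
nra.
Qed.

(** Used throughout to turn vector identities into complex ones that [ring] can close after
    expanding [inner]. *)
Lemma inner_ext x y : (forall z, inner x z = inner y z) -> x = y.
Proof.
intros E. rewrite <- (minus_plus_cancel x y).
replace (minus x y) with (zero : H); [exact (plus_zero_l (y : H))|].
symmetry. apply inner_self_zero. rewrite inner_minus_l, E. ring.
Qed.

Definition self_adjoint (T : BOp H) : Prop :=
  forall x y, inner (T x) y = inner x (T y).

Lemma self_adjoint_id : self_adjoint op_id.
Proof. easy. Qed.

(** Polarization: the form is real at [x], [y], [x + y] and [x + i y]. The last two vectors fix the
    imaginary and the real part of [inner (T x) y - inner x (T y)]. *)
Lemma positive_self_adjoint (T : BOp H) : positive T -> self_adjoint T.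
Proof.
intros HT x y.
destruct (HT x) as [_ hx]. destruct (HT y) as [_ hy].
destruct (HT (plus x y)) as [_ h1].
destruct (HT (plus x (scal (Ci : C_AbsRing) y))) as [_ h2].
rewrite op_add, inner_plus_l, !inner_plus_r in h1.
rewrite op_add, op_smul, inner_plus_l, !inner_plus_r, !inner_scal_l, !inner_scal_r in h2.
rewrite (inner_conj H (T y) x).
destruct (inner (T x) x) as [a1 a2], (inner (T y) y) as [b1 b2],
  (inner (T x) y) as [p1 p2], (inner (T y) x) as [q1 q2].
simpl in *. apply injective_projections; simpl; lra.
Qed.

Lemma self_adjoint_real (T : BOp H) x : self_adjoint T -> Im (inner (T x) x) = 0.
Proof.
intros HT. assert (E : inner (T x) x = Cconj (inner (T x) x))
  by (rewrite <- inner_conj; apply HT).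
apply (f_equal Im) in E. rewrite im_conj in E. lra.
Qed.

Lemma quad_form_plus_scal (T : BOp H) (c : C) x y : self_adjoint T ->
  Re (inner (T (plus x (scal (c : C_AbsRing) y))) (plus x (scal (c : C_AbsRing) y))) =
  Re (inner (T x) x) + 2 * Re (Cconj c * inner (T x) y)%C
    + Cmod c ^ 2 * Re (inner (T y) y).
Proof.
intros HT.
rewrite op_add, op_smul, inner_plus_l, !inner_plus_r, !inner_scal_l, !inner_scal_r.
rewrite (HT y x), (inner_conj H (T x) y), Cmod2_alt.
assert (hy := self_adjoint_real T y HT).
destruct c as [a b], (inner (T x) y) as [p q], (inner (T x) x), (inner (T y) y) as [u v].
simpl in *. subst v. ring.
Qed.

Lemma norm_sq_plus_scal (c : C) x y :
  norm (plus x (scal (c : C_AbsRing) y)) ^ 2 =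
  norm x ^ 2 + 2 * Re (Cconj c * inner x y)%C + Cmod c ^ 2 * norm y ^ 2.
Proof. rewrite !norm_sq. exact (quad_form_plus_scal op_id c x y self_adjoint_id). Qed.

Lemma discriminant_le (a b c : R) :
  0 <= a -> (forall t, 0 <= a * t ^ 2 + 2 * b * t + c) -> b ^ 2 <= a * c.
Proof.
intros ha h. destruct (Req_dec a 0) as [->|Ha].
- destruct (Req_dec b 0) as [->|Hb]; [lra|].
  (* A nonconstant affine function is not bounded below; at this point it takes the value -1. *)
  specialize (h (- (c + 1) / (2 * b))).
  replace (0 * (- (c + 1) / (2 * b)) ^ 2 + 2 * b * (- (c + 1) / (2 * b)) + c)
    with (-1) in h by (field; auto). lra.
(* The minimizer of the parabola. *)
- specialize (h (- b / a)).
  replace (a * (- b / a) ^ 2 + 2 * b * (- b / a) + c) with ((a * c - b ^ 2) / a) in h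
    by (field; auto).
  apply Rmult_le_compat_l with (r := a) in h; [|exact ha].
  replace (a * ((a * c - b ^ 2) / a)) with (a * c - b ^ 2) in h by (field; auto). lra.
Qed.

(** Expanding the form at [x + t c y] with [c = inner (T x) y] and [t] real gives a real quadratic
    in [t]. Its discriminant yields the bound multiplied by [Cmod c ^ 2], which is cancelled when
    [c] is nonzero. *)
Lemma positive_cauchy_schwarz (T : BOp H) x y : positive T ->
  Cmod (inner (T x) y) ^ 2 <= Re (inner (T x) x) * Re (inner (T y) y).
Proof.
intros HT. set (c := inner (T x) y).
assert (hx := proj1 (HT x)). assert (hy := proj1 (HT y)).
assert (hk : 0 <= Cmod c ^ 2) by apply pow2_ge_0.
destruct (Req_dec (Cmod c ^ 2) 0) as [E|E]; [rewrite E; now apply Rmult_le_pos|].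
assert (h : (Cmod c ^ 2) ^ 2 <= (Cmod c ^ 2 * Re (inner (T y) y)) * Re (inner (T x) x)).
{ apply discriminant_le; [now apply Rmult_le_pos|]. intros t.
  assert (h := proj1 (HT (plus x (scal (RtoC t * c : C_AbsRing)%C y)))).
  rewrite quad_form_plus_scal in h by now apply positive_self_adjoint.
  fold c in h. rewrite Cmod_mult, Cmod_R, Rpow_mult_distr, pow2_abs in h.
  assert (E2 : Re (Cconj (RtoC t * c) * c)%C = t * Cmod c ^ 2).
  { rewrite Cmod2_alt. destruct c as [p q]. simpl. ring. }
  rewrite E2 in h. lra. }
apply Rmult_le_reg_l with (Cmod c ^ 2); lra.
Qed.

Lemma positive_id : positive (op_id (H := H)).
Proof. intros x. simpl. rewrite hilbert_norm. simpl. split; [|easy]. nra. Qed.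

Lemma cauchy_schwarz x y : Cmod (inner x y) <= norm x * norm y.
Proof.
assert (h := positive_cauchy_schwarz op_id x y positive_id). simpl in h.
rewrite <- !norm_sq, <- Rpow_mult_distr in h.
apply Rsqr_incr_0_var; [rewrite !Rsqr_pow2; exact h|].
apply Rmult_le_pos; apply norm_ge_0.
Qed.
End HilbertGeometry.

(** * Orthogonal projection onto the closure of a subspace *)

Section Projection.
Context {H : HilbertSpace}.
Implicit Types x y z : H.

(** Completeness is given in terms of balls, which bound the norm only up to [norm_factor]; this
    restates it for the norm. *)
Lemma complete_of_norm (u : nat -> H) :
  (forall e, 0 < e -> exists N, forall n m, (N <= n)%nat -> (N <= m)%nat ->
     norm (minus (u n) (u m)) < e) ->
  exists l, forall e, 0 < e -> exists N, forall n, (N <= n)%nat ->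
     norm (minus (u n) l) < e.
Proof.
intros hc.
destruct (proj1 (@filterlim_locally_cauchy nat
  (CompleteNormedModule.CompleteSpace C_AbsRing H) eventually _ u)) as [l hl].
- intros eps. destruct (hc eps (cond_pos eps)) as [N hN].
  exists (fun n => (N <= n)%nat). split; [now exists N|].
  intros n m hn hm. apply (norm_compat1 (K := C_AbsRing) (u n) (u m)). now apply hN.
- exists l. intros e He.
  assert (Hf := norm_factor_gt_0 (K := C_AbsRing) (V := H)).
  assert (Hd : 0 < e / @norm_factor C_AbsRing H) by now apply Rdiv_lt_0_compat.
  destruct (proj1 (filterlim_locally u l) hl (mkposreal _ Hd)) as [N hN].
  exists N. intros n hn.
  assert (h := norm_compat2 (K := C_AbsRing) (V := H) _ _ _ (hN n hn)). simpl in h.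
  apply Rlt_le_trans with (1 := h). right. field. lra.
Qed.

(** A quantitative first variation: if moving along [y] can lower the squared norm by less than [e],
    then [x] is nearly orthogonal to [y]. Taking multiples [t c] with [c = inner x y] reduces this
    to a discriminant, as for Cauchy-Schwarz. *)
Lemma almost_orthogonal (d e : R) x y :
  (forall c : C, d <= norm (plus x (scal (c : C_AbsRing) y)) ^ 2) ->
  norm x ^ 2 < d + e -> Cmod (inner x y) ^ 2 <= e * norm y ^ 2.
Proof.
intros hd he. set (c := inner x y).
assert (he0 : 0 <= e).
{ specialize (hd (RtoC 0)). rewrite norm_sq_plus_scal, Cmod_0 in hd. simpl in hd. nra. }
assert (h : (Cmod c ^ 2) ^ 2 <= (Cmod c ^ 2 * norm y ^ 2) * e).
{ apply discriminant_le.
  - apply Rmult_le_pos; apply pow2_ge_0.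
  - intros t. assert (h := hd (RtoC t * c)%C).
    rewrite norm_sq_plus_scal in h. fold c in h.
    rewrite Cmod_mult, Cmod_R, Rpow_mult_distr, pow2_abs in h.
    assert (E2 : Re (Cconj (RtoC t * c) * c)%C = t * Cmod c ^ 2).
    { rewrite Cmod2_alt. destruct c as [p q]. simpl. ring. }
    rewrite E2 in h. lra. }
assert (hk := pow2_ge_0 (Cmod c)). assert (hn := pow2_ge_0 (norm y)).
destruct (Req_dec (Cmod c ^ 2) 0) as [E|E]; [rewrite E; now apply Rmult_le_pos|].
apply Rmult_le_reg_l with (Cmod c ^ 2); lra.
Qed.

(** [L] need not be closed, so the foot of the perpendicular is only asked to
    lie in its closure; a minimizing sequence converges by the parallelogram law. *)
Lemma orthogonal_projection (L : H -> Prop) x :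
  L zero -> (forall y z, L y -> L z -> L (plus y z)) ->
  (forall (c : C_AbsRing) y, L y -> L (scal c y)) ->
  exists u, (forall e, 0 < e -> exists l, L l /\ norm (minus l u) < e) /\
    forall l, L l -> inner (minus x u) l = RtoC 0.
Proof.
intros L0 Lp Ls.
assert (Lm : forall y z, L y -> L z -> L (minus y z)).
{ intros y z hy hz. apply Lp; [exact hy|].
  replace (opp z) with (scal (opp one : C_AbsRing) z)
    by exact (scal_opp_one (K := C_AbsRing) (z : H)).
  now apply Ls. }
(* [completeness] supplies suprema, so the squared distances are negated; [d] below is their
   infimum. *)
destruct (completeness (fun r => exists l, L l /\ r = - norm (minus x l) ^ 2))
  as [d' [hub hlub]].
{ exists 0. intros r [l [_ ->]]. assert (h := pow2_ge_0 (norm (minus x l))). lra. }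
{ exists (- norm (minus x zero) ^ 2). now exists zero. }
set (d := - d').
assert (hd : forall l, L l -> d <= norm (minus x l) ^ 2).
{ intros l hl. assert (- norm (minus x l) ^ 2 <= d') by (apply hub; now exists l).
  unfold d. lra. }
assert (hinf : forall e, 0 < e -> exists l, L l /\ norm (minus x l) ^ 2 < d + e).
{ intros e He. apply NNPP. intros hn.
  assert (d' <= d' - e); [|lra]. apply hlub. intros r [l [hl ->]].
  apply Rnot_lt_le. intros h. apply hn. exists l. split; [exact hl|]. unfold d. lra. }
assert (orth : forall e l l', 0 < e -> L l -> L l' -> norm (minus x l) ^ 2 < d + e ->
  Cmod (inner (minus x l) l') ^ 2 <= e * norm l' ^ 2).
{ intros e l l' He hl hl' hle. apply almost_orthogonal with d; auto. intros c.
  apply Rle_trans with (1 := hd _ (Lm _ _ hl (Ls c _ hl'))). right. do 2 f_equal.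
  apply inner_ext; intros z. rewrite inner_plus_l, !inner_minus_l. ring. }
destruct (choice (fun (n : nat) l => L l /\ norm (minus x l) ^ 2 < d + / (INR n + 1)))
  as [s hs].
{ intros n. apply hinf. apply Rinv_0_lt_compat. assert (h := pos_INR n). lra. }
assert (hsmall : forall e, 0 < e -> exists N, forall n, (N <= n)%nat -> / (INR n + 1) < e).
{ intros e He. destruct (archimed_cor1 e He) as [N [hN hN0]]. exists N. intros n hn.
  apply Rle_lt_trans with (2 := hN). apply Rinv_le_contravar.
  - now apply lt_0_INR.
  - apply le_INR in hn. lra. }
destruct (complete_of_norm s) as [u hu].
(* With both squared distances below [d + e ^ 2 / 4] and the midpoint's at least [d], the
   parallelogram law leaves less than [e ^ 2] for the squared norm of the difference. *)
{ intros e He. destruct (hsmall (e ^ 2 / 4)) as [N hN]; [nra|].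
  exists N. intros n m hn hm.
  destruct (hs n) as [ln dn], (hs m) as [lm dm].
  pose (mid := (scal (RtoC (/ 2) : C_AbsRing) (plus (s n) (s m)) : H)).
  assert (hmid : d <= norm (minus x mid) ^ 2) by (apply hd, Ls, Lp; assumption).
  assert (par : norm (minus (s n) (s m)) ^ 2 + 4 * norm (minus x mid) ^ 2
     = 2 * norm (minus x (s n)) ^ 2 + 2 * norm (minus x (s m)) ^ 2).
  { unfold mid. rewrite !norm_sq, !inner_minus_l, !inner_minus_r, !inner_scal_l, !inner_scal_r,
      !inner_plus_l, !inner_plus_r.
    simpl. field. }
  specialize (hN n hn) as hNn. specialize (hN m hm) as hNm.
  apply Rsqr_incrst_0; [rewrite !Rsqr_pow2; lra|apply norm_ge_0|lra]. }
exists u. split.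
- intros e He. destruct (hu e He) as [N hN]. exists (s N).
  split; [apply hs|apply hN; lia].
- intros l hl. apply Cmod_eq_0. apply Rle_antisym; [|apply Cmod_ge_0].
  apply le_epsilon. intros e He. rewrite Rplus_0_l.
  (* The inner product splits at [s n] into two terms, each at most [e / (2 * K) * norm l], hence at
     most [e / 2]; the added 1 keeps [K] positive. *)
  set (K := norm l + 1). assert (hl0 := norm_ge_0 l).
  assert (hK : 0 < K) by (unfold K; lra).
  assert (he2 : 0 < e / (2 * K)) by (apply Rdiv_lt_0_compat; lra).
  destruct (hu _ he2) as [N1 hN1].
  destruct (hsmall ((e / (2 * K)) ^ 2)) as [N2 hN2]; [nra|].
  set (n := (N1 + N2)%nat).
  specialize (hN1 n ltac:(unfold n; lia)). specialize (hN2 n ltac:(unfold n; lia)).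
  destruct (hs n) as [ln dn].
  assert (hn0 : 0 < / (INR n + 1))
    by (apply Rinv_0_lt_compat; assert (h := pos_INR n); lra).
  assert (ho := orth _ _ _ hn0 ln hl dn).
  assert (h1 : Cmod (inner (minus x (s n)) l) <= e / (2 * K) * norm l).
  { apply Rsqr_incr_0_var; [|apply Rmult_le_pos; lra]. rewrite !Rsqr_pow2.
    rewrite Rpow_mult_distr. apply Rle_trans with (1 := ho).
    apply Rmult_le_compat_r; [apply pow2_ge_0|lra]. }
  assert (h2 := cauchy_schwarz (minus (s n) u) l).
  assert (h3 : norm (minus (s n) u) * norm l <= e / (2 * K) * norm l)
    by (apply Rmult_le_compat_r; lra).
  assert (h4 : e / (2 * K) * norm l <= e / (2 * K) * K)
    by (apply Rmult_le_compat_l; [lra|unfold K; lra]).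
  replace (e / (2 * K) * K) with (e / 2) in h4 by (field; lra).
  replace (inner (minus x u) l) with (inner (minus x (s n)) l + inner (minus (s n) u) l)%C
    by (rewrite !inner_minus_l; ring).
  apply Rle_trans with (1 := Cmod_triangle _ _). lra.
Qed.

(** * Riesz representation and existence of adjoints *)

Lemma op_sub (A : BOp H) x y : A (minus x y) = minus (A x) (A y).
Proof.
replace (minus x y) with (plus x (scal (- RtoC 1 : C_AbsRing)%C y))
  by (apply inner_ext; intros z; rewrite inner_plus_l, inner_scal_l, inner_minus_l; ring).
rewrite op_add, op_smul. apply inner_ext; intros z.
rewrite inner_plus_l, inner_scal_l, inner_minus_l. ring.
Qed.

(** Project a vector outside the kernel of the functional [f x = inner (A x) y] onto that kernel.
    The remainder [w] is orthogonal to the kernel, and a multiple of [w] represents [f]. *)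
Lemma riesz_representation (A : BOp H) y : exists b, forall x, inner (A x) y = inner x b.
Proof.
destruct (classic (exists x, inner (A x) y <> RtoC 0)) as [[x0 hx0]|hn].
- destruct (orthogonal_projection (fun x => inner (A x) y = RtoC 0) x0) as [u [hu ho]].
  + rewrite op_0. apply inner_zero_l.
  + intros v w hv hw. rewrite op_add, inner_plus_l, hv, hw. ring.
  + intros c v hv. rewrite op_smul, inner_scal_l, hv. ring.
  (* The projection only places [u] in the closure of the kernel; boundedness of [A] puts it in the
     kernel itself. *)
  + assert (fu : inner (A u) y = RtoC 0).
    { apply Cmod_eq_0. apply Rle_antisym; [|apply Cmod_ge_0].
      apply le_epsilon. intros e He. rewrite Rplus_0_l.
      assert (hA := op_norm_ge0 A). assert (hy := norm_ge_0 y).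
      set (K := op_norm A * norm y + 1).
      assert (hK : 0 < K) by (unfold K; assert (h := Rmult_le_pos _ _ hA hy); lra).
      destruct (hu (e / K)) as [l [hl hlu]]; [now apply Rdiv_lt_0_compat|].
      replace (inner (A u) y) with (- inner (A (minus l u)) y)%C
        by (rewrite op_sub, inner_minus_l, hl; ring).
      rewrite Cmod_opp. apply Rle_trans with (1 := cauchy_schwarz _ _).
      apply Rle_trans with (op_norm A * (e / K) * norm y).
      - apply Rmult_le_compat_r; [exact hy|]. apply Rle_trans with (1 := op_norm_apply _ _).
        apply Rmult_le_compat_l; lra.
      - replace (op_norm A * (e / K) * norm y) with ((op_norm A * norm y) * (e / K)) by ring.
        replace e with (K * (e / K)) at 2 by (field; lra).
        apply Rmult_le_compat_r; [left; now apply Rdiv_lt_0_compat|unfold K; lra]. }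
    assert (hw : exists w, inner (A w) y <> RtoC 0 /\
      forall l, inner (A l) y = RtoC 0 -> inner w l = RtoC 0).
    { exists (minus x0 u). split; [|exact ho].
      rewrite op_sub, inner_minus_l, fu. intros h. apply hx0. rewrite <- h. ring. }
    destruct hw as [w [hw how]].
    assert (hn : RtoC (norm w ^ 2) <> RtoC 0).
    { intros E. apply hw. rewrite <- hilbert_norm in E.
      rewrite (inner_self_zero w E), op_0. apply inner_zero_l. }
    (* The scalar is forced by testing at [w]. It works at every [x] because [x - k w], with [k] the
       quotient of the functional's values at [x] and [w], lies in the kernel. *)
    exists (scal (Cconj (inner (A w) y / RtoC (norm w ^ 2)) : C_AbsRing) w).
    intros x. set (k := (inner (A x) y / inner (A w) y)%C).
    assert (hk : inner w (minus x (scal (k : C_AbsRing) w)) = RtoC 0).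
    { apply how. rewrite op_sub, op_smul, inner_minus_l, inner_scal_l. unfold k.
      field. exact hw. }
    rewrite inner_minus_r, inner_scal_r, hilbert_norm in hk.
    assert (hx : inner w x = (Cconj k * RtoC (norm w ^ 2))%C).
    { transitivity (inner w x - Cconj k * RtoC (norm w ^ 2) + Cconj k * RtoC (norm w ^ 2))%C;
        [ring|rewrite hk; ring]. }
    rewrite inner_scal_r, Cconj_conj, (inner_conj H w x), hx, Cmult_conj, Cconj_conj.
    replace (Cconj (RtoC (norm w ^ 2))) with (RtoC (norm w ^ 2))
      by (unfold Cconj, RtoC; simpl; now rewrite Ropp_0).
    unfold k. field. now split.
- exists zero. intros x. rewrite inner_zero_r. apply NNPP. intros h. apply hn. now exists x.
Qed.

Lemma adjoint_spec (A : BOp H) x y : inner (A x) y = inner x (adjoint A y).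
Proof.
revert x y. unfold adjoint. apply epsilon_spec.
destruct (choice _ (riesz_representation A)) as [B hB].
assert (Bl : @is_linear C_AbsRing H H B).
{ assert (ext_r : forall u v : H, (forall z, inner z u = inner z v) -> u = v).
  { intros u v h. apply inner_ext. intros z. rewrite (inner_conj H z u), h.
    symmetry. apply inner_conj. }
  split.
  - intros x y. apply ext_r. intros z.
    transitivity (inner z (B x) + inner z (B y))%C;
      [rewrite <- !hB|symmetry]; apply inner_plus_r.
  - intros k x. apply ext_r. intros z.
    transitivity (Cconj k * inner z (B x))%C;
      [rewrite <- !hB|symmetry]; apply inner_scal_r.
  (* The squared norm of [B y] equals [inner (A (B y)) y], at most
     [op_norm A * norm (B y) * norm y]; one factor [norm (B y)] cancels. The added 1 makes the
     constant strictly positive, as [is_linear] demands. *)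
  - exists (op_norm A + 1). assert (hA := op_norm_ge0 A). split; [lra|]. intros y.
    assert (h := norm_sq (B y)). rewrite <- hB in h.
    assert (h1 := re_le_Cmod (inner (A (B y)) y)).
    assert (h2 := Rle_abs (Re (inner (A (B y)) y))).
    assert (h3 := cauchy_schwarz (A (B y)) y).
    assert (h4 := op_norm_apply A (B y)).
    assert (hy := norm_ge_0 y). assert (hb := norm_ge_0 (B y)).
    assert (h5 : norm (A (B y)) * norm y <= op_norm A * norm (B y) * norm y)
      by (apply Rmult_le_compat_r; assumption).
    destruct (Req_dec (norm (B y)) 0) as [E|E].
    + rewrite E. apply Rmult_le_pos; lra.
    + apply Rmult_le_reg_l with (norm (B y)); [lra|].
      assert (0 <= norm (B y) * norm y) by now apply Rmult_le_pos.
      replace (norm (B y) * ((op_norm A + 1) * norm y))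
        with (op_norm A * norm (B y) * norm y + norm (B y) * norm y) by ring.
      lra. }
now exists (Build_BOp H B Bl).
Qed.
End Projection.

(** * Convergence of vectors and positive square roots by iteration *)

Section SquareRoot.
Context {H : HilbertSpace}.
Implicit Types x y z : H.

Definition tends (u : nat -> H) (l : H) : Prop :=
  is_lim_seq (fun n => norm (minus (u n) l)) 0.

Lemma is_lim_seq_squeeze_0 (a b : nat -> R) :
  (forall n, 0 <= a n <= b n) -> is_lim_seq b 0 -> is_lim_seq a 0.
Proof.
intros hab hb. apply is_lim_seq_le_le with (fun _ => 0) b; auto. apply is_lim_seq_const.
Qed.

Lemma tends_squeeze (u : nat -> H) l (b : nat -> R) :
  (forall n, norm (minus (u n) l) <= b n) -> is_lim_seq b 0 -> tends u l.
Proof.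
intros hb. apply is_lim_seq_squeeze_0. intros n. split; [apply norm_ge_0|apply hb].
Qed.

Lemma is_lim_seq_plus_0 (a b : nat -> R) :
  is_lim_seq a 0 -> is_lim_seq b 0 -> is_lim_seq (fun n => a n + b n) 0.
Proof.
intros ha hb. replace 0 with (0 + 0) by ring. now apply is_lim_seq_plus'.
Qed.

Lemma is_lim_seq_scal_0 (c : R) (a : nat -> R) :
  is_lim_seq a 0 -> is_lim_seq (fun n => c * a n) 0.
Proof.
intros ha. replace (Finite 0) with (Rbar_mult c 0) by (simpl; f_equal; ring).
now apply is_lim_seq_scal_l.
Qed.

Lemma norm_zero_of_tends (l : H) (b : nat -> R) :
  (forall n, norm l <= b n) -> is_lim_seq b 0 -> l = zero.
Proof.
intros hb hl. apply norm_eq_0. apply Rle_antisym; [|apply norm_ge_0].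
exact (is_lim_seq_le (fun _ => norm l) b (norm l) 0 hb (is_lim_seq_const _) hl).
Qed.

Lemma minus_zero_eq x y : minus x y = zero -> x = y.
Proof.
intros E. rewrite <- (minus_plus_cancel x y), E. exact (plus_zero_l (y : H)).
Qed.

Lemma tends_unique (u : nat -> H) l m : tends u l -> tends u m -> l = m.
Proof.
intros hl hm. apply minus_zero_eq. eapply norm_zero_of_tends.
2: exact (is_lim_seq_plus_0 _ _ hl hm).
intros n. simpl. rewrite (norm_minus_sym (u n) l). apply norm_minus_trans.
Qed.

Lemma tends_ext (u v : nat -> H) l : (forall n, u n = v n) -> tends u l -> tends v l.
Proof. intros h. apply is_lim_seq_ext. intros n. now rewrite h. Qed.

Lemma tends_const l : tends (fun _ => l) l.
Proof.
apply tends_squeeze with (fun _ => 0); [|apply is_lim_seq_const].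
intros n. right. transitivity (norm (zero : H)); [|apply norm_0].
f_equal. exact (minus_eq_zero (l : H)).
Qed.

Lemma tends_S (u : nat -> H) l : tends u l -> tends (fun n => u (S n)) l.
Proof. exact (proj1 (is_lim_seq_incr_1 (fun n => norm (minus (u n) l)) 0)). Qed.

Lemma tends_plus (u v : nat -> H) l m :
  tends u l -> tends v m -> tends (fun n => plus (u n) (v n)) (plus l m).
Proof.
intros hu hv. eapply tends_squeeze; [|exact (is_lim_seq_plus_0 _ _ hu hv)].
intros n. apply norm_minus_plus_le.
Qed.

Lemma tends_op (A : BOp H) (u : nat -> H) l : tends u l -> tends (fun n => A (u n)) (A l).
Proof.
intros hu. eapply tends_squeeze; [|exact (is_lim_seq_scal_0 (op_norm A) _ hu)].
intros n. rewrite <- op_sub. apply op_norm_apply.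
Qed.

(** Lets the limit pass through [Y n (Y n x)] in the recursion: the contractions [Y n] carry the
    error of [u n] without enlarging it. *)
Lemma tends_op_seq (Y : nat -> BOp H) (L : BOp H) (u : nat -> H) l :
  (forall n x, norm (Y n x) <= norm x) -> (forall x, tends (fun n => Y n x) (L x)) ->
  tends u l -> tends (fun n => Y n (u n)) (L l).
Proof.
intros hY hL hu. eapply tends_squeeze; [|exact (is_lim_seq_plus_0 _ _ hu (hL l))].
intros n. simpl. apply Rle_trans with (1 := norm_minus_trans (Y n l) _ _).
apply Rplus_le_compat_r. rewrite <- op_sub. apply hY.
Qed.

Lemma tends_norm_le (u : nat -> H) l (M : R) :
  tends u l -> (forall n, norm (u n) <= M) -> norm l <= M.
Proof.
intros hu hM.
assert (h : Rbar_le (norm l) (0 + M)).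
{ apply (is_lim_seq_le (fun _ => norm l) (fun n => norm (minus (u n) l) + M)).
  - intros n. rewrite <- (minus_plus_cancel l (u n)) at 1.
    apply Rle_trans with (1 := norm_plus_le _ _). rewrite norm_minus_sym.
    apply Rplus_le_compat_l, hM.
  - apply is_lim_seq_const.
  - apply is_lim_seq_plus'; [exact hu|apply is_lim_seq_const]. }
simpl in h. lra.
Qed.

Lemma tends_self_adjoint (Y : nat -> BOp H) (L : BOp H) :
  (forall n, self_adjoint (Y n)) -> (forall x, tends (fun n => Y n x) (L x)) ->
  self_adjoint L.
Proof.
intros hY hL x y.
assert (E : Cmod (inner (L x) y - inner x (L y))%C <= 0).
{ apply (is_lim_seq_le (fun _ => Cmod (inner (L x) y - inner x (L y))%C)
    (fun n => norm y * norm (minus (Y n x) (L x)) + norm x * norm (minus (Y n y) (L y)))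
    (Cmod (inner (L x) y - inner x (L y))%C) 0).
  - intros n.
    replace (inner (L x) y - inner x (L y))%C
      with (- inner (minus (Y n x) (L x)) y + inner x (minus (Y n y) (L y)))%C
      by (rewrite inner_minus_l, inner_minus_r, (hY n x y); ring).
    apply Rle_trans with (1 := Cmod_triangle _ _). rewrite Cmod_opp.
    rewrite (Rmult_comm (norm y)). apply Rplus_le_compat; apply cauchy_schwarz.
  - apply is_lim_seq_const.
  - apply is_lim_seq_plus_0; apply is_lim_seq_scal_0, hL. }
assert (h : (inner (L x) y - inner x (L y))%C = RtoC 0).
{ apply Cmod_eq_0. apply Rle_antisym; [exact E|apply Cmod_ge_0]. }
transitivity (inner (L x) y - inner x (L y) + inner x (L y))%C; [ring|rewrite h; ring].
Qed.

(** With [B = I - T], a fixed point [Y] of the iteration satisfies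
    [(I - Y)^2 = I - B = T]. *)
Fixpoint sqrt_iter (B : BOp H) (n : nat) : BOp H :=
  match n with
  | O => op_zero
  | S n => op_scal (/ 2) (op_plus B (op_sqr (sqrt_iter B n)))
  end.

(** The scalar iteration with [B = 1], which majorizes [sqrt_iter]. *)
Fixpoint sqrt_iter_R (n : nat) : R :=
  match n with
  | O => 0
  | S n => / 2 * (1 + sqrt_iter_R n ^ 2)
  end.

Lemma sqrt_iter_R_bounds n : 0 <= sqrt_iter_R n <= 1.
Proof. induction n as [|n IH]; simpl in *; nra. Qed.

(** The increment is half the square of [1 - sqrt_iter_R n]. *)
Lemma sqrt_iter_R_incr n : sqrt_iter_R n <= sqrt_iter_R (S n).
Proof. simpl. assert (h := sqrt_iter_R_bounds n). nra. Qed.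

Lemma norm_scal_half x : norm (scal (RtoC (/ 2) : C_AbsRing) x) <= / 2 * norm x.
Proof. apply Rle_trans with (1 := norm_scal_RtoC _ _). rewrite Rabs_pos_eq; lra. Qed.

Section Iteration.
Context (B : BOp H) (B_le1 : forall x, norm (B x) <= norm x).

Lemma sqrt_iter_norm n x : norm (sqrt_iter B n x) <= sqrt_iter_R n * norm x.
Proof.
revert x. induction n as [|n IH]; intros x; simpl.
- rewrite norm_0. lra.
- apply Rle_trans with (1 := norm_scal_half _).
  assert (h := norm_plus_le (B x) (sqrt_iter B n (sqrt_iter B n x))).
  assert (hB := B_le1 x).
  assert (h1 := IH (sqrt_iter B n x)). assert (h2 := IH x).
  assert (hb := sqrt_iter_R_bounds n).
  assert (h3 : sqrt_iter_R n * norm (sqrt_iter B n x)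
    <= sqrt_iter_R n * (sqrt_iter_R n * norm x)) by (apply Rmult_le_compat_l; lra).
  apply Rle_trans with (/ 2 * (norm x + sqrt_iter_R n * (sqrt_iter_R n * norm x))).
  + apply Rmult_le_compat_l; lra.
  + right. ring.
Qed.

Lemma sqrt_iter_diff_S n x :
  norm (minus (sqrt_iter B (S n) x) (sqrt_iter B n x))
    <= (sqrt_iter_R (S n) - sqrt_iter_R n) * norm x.
Proof.
revert x. induction n as [|n IH]; intros x.
- replace (minus (sqrt_iter B 1 x) (sqrt_iter B 0 x)) with (sqrt_iter B 1 x)
    by (apply inner_ext; intros z; rewrite inner_minus_l; simpl;
        rewrite inner_zero_l; ring).
  apply Rle_trans with (1 := sqrt_iter_norm 1 x). simpl. lra.
- set (Y1 := sqrt_iter B (S n)) in *. set (Y0 := sqrt_iter B n) in *.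
  set (y1 := sqrt_iter_R (S n)) in *. set (y0 := sqrt_iter_R n) in *.
  (* The difference of squares is split as [Y1 (Y1 - Y0) + (Y1 - Y0) Y0]. Bounding both terms
     reproduces the scalar increment, by the factorization of [y1 ^ 2 - y0 ^ 2]. *)
  replace (minus (sqrt_iter B (S (S n)) x) (Y1 x)) with
    (scal (RtoC (/ 2) : C_AbsRing)
      (plus (Y1 (minus (Y1 x) (Y0 x))) (minus (Y1 (Y0 x)) (Y0 (Y0 x))))).
  2:{ apply inner_ext; intros z.
      rewrite op_sub, inner_scal_l, inner_plus_l, !inner_minus_l.
      change (sqrt_iter B (S (S n)) x) with
        (scal (RtoC (/ 2) : C_AbsRing) (plus (B x) (Y1 (Y1 x)))).
      replace (inner (Y1 x) z) with
        (inner (scal (RtoC (/ 2) : C_AbsRing) (plus (B x) (Y0 (Y0 x)))) z) by reflexivity.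
      rewrite !inner_scal_l, !inner_plus_l. ring. }
  apply Rle_trans with (1 := norm_scal_half _).
  assert (h := norm_plus_le (Y1 (minus (Y1 x) (Y0 x))) (minus (Y1 (Y0 x)) (Y0 (Y0 x)))).
  assert (h1 := sqrt_iter_norm (S n) (minus (Y1 x) (Y0 x))). fold Y1 y1 in h1.
  assert (h2 := IH x). assert (h3 := IH (Y0 x)).
  assert (h4 := sqrt_iter_norm n x). fold Y0 y0 in h4.
  assert (hy1 := sqrt_iter_R_bounds (S n)). fold y1 in hy1.
  assert (hinc := sqrt_iter_R_incr n). fold y1 y0 in hinc.
  assert (h5 : y1 * norm (minus (Y1 x) (Y0 x)) <= y1 * ((y1 - y0) * norm x))
    by (apply Rmult_le_compat_l; lra).
  assert (h6 : (y1 - y0) * norm (Y0 x) <= (y1 - y0) * (y0 * norm x))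
    by (apply Rmult_le_compat_l; lra).
  apply Rle_trans with (/ 2 * (y1 * ((y1 - y0) * norm x) + (y1 - y0) * (y0 * norm x))).
  + apply Rmult_le_compat_l; lra.
  + right. change (sqrt_iter_R (S (S n))) with (/ 2 * (1 + y1 ^ 2)).
    assert (E : y1 = / 2 * (1 + y0 ^ 2)) by reflexivity.
    replace (/ 2 * (1 + y1 ^ 2) - y1) with (/ 2 * (y1 ^ 2 - y0 ^ 2)) by lra. ring.
Qed.

Lemma sqrt_iter_diff n k x :
  norm (minus (sqrt_iter B (n + k) x) (sqrt_iter B n x))
    <= (sqrt_iter_R (n + k) - sqrt_iter_R n) * norm x.
Proof.
induction k as [|k IH].
- rewrite Nat.add_0_r. right. rewrite Rminus_diag, Rmult_0_l, <- (norm_0 (H := H)).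
  f_equal. exact (minus_eq_zero (sqrt_iter B n x : H)).
- rewrite Nat.add_succ_r.
  apply Rle_trans with (1 := norm_minus_trans (sqrt_iter B (n + k) x) _ _).
  assert (h := sqrt_iter_diff_S (n + k) x). lra.
Qed.

(** The scalar majorant increases and is bounded by 1, hence Cauchy; its increments dominate those
    of the operators, so these converge in norm. *)
Lemma sqrt_iter_limit : exists L : BOp H, forall x, tends (fun n => sqrt_iter B n x) (L x).
Proof.
assert (hc : ex_finite_lim_seq sqrt_iter_R).
{ apply ex_finite_lim_seq_incr with 1; [exact sqrt_iter_R_incr|apply sqrt_iter_R_bounds]. }
apply ex_lim_seq_cauchy_corr in hc.
destruct (op_lim_exists (filtermap (sqrt_iter B) eventually)) as [L hL].
{ apply filtermap_proper_filter, eventually_filter. }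
{ intros e. assert (He := cond_pos e). assert (he2 : 0 < e / 2) by lra.
  destruct (hc (mkposreal _ he2)) as [N hN]. exists (sqrt_iter B N). exists N.
  intros n hn. change (op_norm (minus (sqrt_iter B n) (sqrt_iter B N)) < e).
  apply Rle_lt_trans with (e / 2); [|lra]. apply op_norm_le. intros x hx.
  rewrite op_minus_apply. replace n with (N + (n - N))%nat by lia.
  apply Rle_trans with (1 := sqrt_iter_diff _ _ _).
  specialize (hN (N + (n - N))%nat N ltac:(lia) ltac:(lia)). simpl in hN.
  apply Rabs_def2 in hN. assert (hx0 := norm_ge_0 x).
  assert (0 <= sqrt_iter_R (N + (n - N)) - sqrt_iter_R N).
  { assert (hm : forall k, sqrt_iter_R N <= sqrt_iter_R (N + k)).
    { induction k as [|k IH]; [rewrite Nat.add_0_r; lra|]. rewrite Nat.add_succ_r.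
      apply Rle_trans with (1 := IH). apply sqrt_iter_R_incr. }
    specialize (hm (n - N)%nat). lra. }
  nra. }
exists L. intros x.
assert (hop : is_lim_seq (fun n => op_norm (minus (sqrt_iter B n) L)) 0).
{ apply is_lim_seq_spec. intros e. destruct (hL e) as [N hN]. exists N. intros n hn.
  rewrite Rminus_0_r, Rabs_pos_eq by apply op_norm_ge0. exact (hN n hn). }
eapply tends_squeeze; [|exact (is_lim_seq_scal_0 (norm x) _ hop)].
intros n. simpl. rewrite <- op_minus_apply, Rmult_comm. apply op_norm_apply.
Qed.
End Iteration.

Lemma sqrt_iter_self_adjoint (B : BOp H) n :
  self_adjoint B -> self_adjoint (sqrt_iter B n).
Proof.
intros hB. induction n as [|n IH]; intros x y; simpl.
- now rewrite inner_zero_l, inner_zero_r.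
- rewrite inner_scal_l, inner_scal_r, inner_plus_l, inner_plus_r, (hB x y), !IH.
  f_equal. unfold Cconj; simpl. now rewrite Ropp_0.
Qed.

Lemma sqrt_iter_commute (B C : BOp H) n :
  (forall x, C (B x) = B (C x)) -> forall x, C (sqrt_iter B n x) = sqrt_iter B n (C x).
Proof.
intros hB. induction n as [|n IH]; intros x; simpl.
- apply op_0.
- now rewrite op_smul, op_add, hB, !IH.
Qed.

(** Cauchy-Schwarz for the form of [T] at [x] and [T x] bounds the fourth power of [norm (T x)] by
    [Re (inner (T x) x) * norm (T x) ^ 2]. *)
Lemma positive_norm_apply_sq (T : BOp H) x :
  positive T -> (forall z, norm (T z) <= norm z) -> norm (T x) ^ 2 <= Re (inner (T x) x).
Proof.
intros HT hT. assert (h := positive_cauchy_schwarz T x (T x) HT).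
assert (h1 := Rle_trans _ _ _ (Rle_abs _) (re_le_Cmod (inner (T (T x)) (T x)))).
assert (h2 := cauchy_schwarz (T (T x)) (T x)). assert (h3 := hT (T x)).
assert (hn := norm_ge_0 (T x)). assert (hx := proj1 (HT x)).
rewrite hilbert_norm, Cmod_R, pow2_abs in h.
assert (h4 : Re (inner (T (T x)) (T x)) <= norm (T x) ^ 2) by nra.
assert (h5 : (norm (T x) ^ 2) ^ 2 <= Re (inner (T x) x) * norm (T x) ^ 2).
{ apply Rle_trans with (1 := h). now apply Rmult_le_compat_l. }
destruct (Req_dec (norm (T x)) 0) as [E|E]; [rewrite E; lra|].
apply Rmult_le_reg_r with (norm (T x) ^ 2); nra.
Qed.

(** The root is [I - L], with [L] the limit of the iteration for [B = I - T]. Whatever commutes with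
    [T] commutes with every iterate and so with the limit. *)
Lemma positive_sqrt_contraction (T : BOp H) :
  positive T -> (forall x, norm (T x) <= norm x) ->
  exists P : BOp H, positive P /\ op_sqr P = T /\
    forall C : BOp H, (forall x, C (T x) = T (C x)) -> forall x, C (P x) = P (C x).
Proof.
intros HT hT. pose (B := minus op_id T : BOp H).
assert (hBx : forall x, B x = minus x (T x)) by (intros x; apply op_minus_apply).
assert (hsa := positive_self_adjoint T HT).
(* The squared norm of [x - T x] is that of [x], minus [2 <Tx,x>], plus that of [T x], and the last
   is at most [<Tx,x>]. *)
assert (hB : forall x, norm (B x) <= norm x).
{ intros x. rewrite hBx. apply Rsqr_incr_0_var; [|apply norm_ge_0]. rewrite !Rsqr_pow2.
  assert (h := positive_norm_apply_sq T x HT hT). assert (hx := proj1 (HT x)).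
  rewrite (norm_sq (minus x (T x))), inner_minus_l, !inner_minus_r.
  rewrite <- (hsa x x), !hilbert_norm. unfold Re in *. simpl in *. lra. }
assert (hBsa : self_adjoint B).
{ intros x y. now rewrite !hBx, inner_minus_l, inner_minus_r, (hsa x y). }
destruct (sqrt_iter_limit B hB) as [L hL].
assert (hY1 : forall n x, norm (sqrt_iter B n x) <= norm x).
{ intros n x. assert (h := sqrt_iter_norm B hB n x). assert (hb := sqrt_iter_R_bounds n).
  assert (hx := norm_ge_0 x). nra. }
assert (hL1 : forall x, norm (L x) <= norm x).
{ intros x. exact (tends_norm_le _ _ _ (hL x) (fun n => hY1 n x)). }
assert (hLsa : self_adjoint L)
  by exact (tends_self_adjoint _ L (fun n => sqrt_iter_self_adjoint B n hBsa) hL).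
assert (hfix : forall x, L x = scal (RtoC (/ 2) : C_AbsRing) (plus (B x) (L (L x)))).
{ intros x. apply (tends_unique (fun n => sqrt_iter B (S n) x)).
  - exact (tends_S _ _ (hL x)).
  - apply (tends_op (op_scal (/ 2) op_id)
      (fun n => plus (B x) (sqrt_iter B n (sqrt_iter B n x)))).
    apply tends_plus; [apply tends_const|].
    exact (tends_op_seq _ L _ _ hY1 hL (hL x)). }
pose (P := minus op_id L : BOp H).
assert (hPx : forall x, P x = minus x (L x)) by (intros x; apply op_minus_apply).
exists P. split; [|split].
- intros x. rewrite hPx, inner_minus_l, hilbert_norm.
  assert (h := self_adjoint_real L x hLsa).
  assert (h1 := Rle_trans _ _ _ (Rle_abs _) (re_le_Cmod (inner (L x) x))).
  assert (h2 := cauchy_schwarz (L x) x). assert (h3 := hL1 x).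
  assert (hx := norm_ge_0 x). unfold Re, Im in *. simpl in *. split; [|lra]. nra.
- apply op_ext. intros x. change (P (P x) = T x). rewrite !hPx, op_sub.
  apply inner_ext. intros z. rewrite !inner_minus_l.
  assert (E : inner (L x) z = inner (scal (RtoC (/ 2) : C_AbsRing) (plus (B x) (L (L x)))) z)
    by now rewrite <- hfix.
  rewrite inner_scal_l, inner_plus_l, hBx, inner_minus_l in E.
  (* The fixed-point equation solved for the square: [L^2 = 2 L - (I - T)], so [(I - L)^2 = T]. *)
  assert (E2 : inner (L (L x)) z =
    (RtoC 2 * inner (L x) z - (inner x z - inner (T x) z))%C).
  { rewrite E, RtoC_inv by lra. field. }
  rewrite E2. ring.
- intros C hC x. rewrite !hPx, op_sub. f_equal.
  apply (tends_unique (fun n => sqrt_iter B n (C x))); [|apply hL].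
  apply tends_ext with (fun n => C (sqrt_iter B n x)).
  + intros n. apply sqrt_iter_commute. intros z. now rewrite !hBx, op_sub, hC.
  + apply tends_op, hL.
Qed.

(** Scale [T] down to a contraction, take the root there, and scale it back by [sqrt M]. The 1 in
    [M] keeps the divisor positive when [T] is zero. *)
Lemma positive_sqrt_exists (T : BOp H) : positive T ->
  exists P : BOp H, positive P /\ op_sqr P = T /\
    forall C : BOp H, (forall x, C (T x) = T (C x)) -> forall x, C (P x) = P (C x).
Proof.
intros HT. set (M := op_norm T + 1).
assert (hM : 0 < M) by (assert (h := op_norm_ge0 T); unfold M; lra).
assert (hMi : 0 < / M) by now apply Rinv_0_lt_compat.
destruct (positive_sqrt_contraction (op_scal (/ M) T)) as [P [hP [hPT hC]]].
- intros x. simpl. rewrite inner_scal_l. destruct (HT x) as [h1 h2].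
  unfold Re, Im in *. simpl. rewrite h2. split; [|ring].
  rewrite Rmult_0_l, Rminus_0_r. apply Rmult_le_pos; lra.
- intros x. simpl. apply Rle_trans with (1 := norm_scal_RtoC _ _).
  rewrite Rabs_pos_eq by lra. assert (h := op_norm_apply T x). assert (hx := norm_ge_0 x).
  apply Rmult_le_reg_l with M; [exact hM|].
  rewrite <- Rmult_assoc, Rinv_r, Rmult_1_l by lra. unfold M. lra.
- exists (op_scal (sqrt M) P). split; [|split].
  + intros x. simpl. rewrite inner_scal_l. destruct (hP x) as [h1 h2].
    unfold Re, Im in *. simpl. rewrite h2. split; [|ring].
    rewrite Rmult_0_l, Rminus_0_r. apply Rmult_le_pos; [apply sqrt_pos|exact h1].
  + apply op_ext. intros x. assert (E := f_equal (fun S : BOp H => S x) hPT).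
    simpl in E |- *. apply inner_ext. intros z.
    rewrite op_smul, E, !inner_scal_l, !Cmult_assoc, <- !RtoC_mult.
    rewrite sqrt_sqrt, Rinv_r by lra. ring.
  + intros C hCT x. simpl. rewrite op_smul. f_equal. apply hC. intros z. simpl.
    now rewrite op_smul, hCT.
Qed.
End SquareRoot.

(** * Absolute values of operators and the mixed Schwarz inequality *)

Section MixedSchwarz.
Context {H : HilbertSpace}.
Implicit Types x y z : H.
Implicit Types A P Q : BOp H.

Lemma adjoint_spec_l A x y : inner (adjoint A x) y = inner x (A y).
Proof. now rewrite inner_conj, <- adjoint_spec, <- inner_conj. Qed.

Lemma adjoint_adjoint A : adjoint (adjoint A) = A.
Proof.
apply op_ext. intros x. apply inner_ext. intros y.
now rewrite adjoint_spec_l, <- adjoint_spec.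
Qed.

Lemma norm_sq_adjoint_comp A x : RtoC (norm (A x) ^ 2) = inner (adjoint A (A x)) x.
Proof. now rewrite adjoint_spec_l, hilbert_norm. Qed.

Lemma op_abs_spec A :
  positive (op_abs A) /\ op_sqr (op_abs A) = op_comp (adjoint A) A.
Proof.
unfold op_abs, op_sqrt. apply epsilon_spec.
destruct (positive_sqrt_exists (op_comp (adjoint A) A)) as [P [hP [hPT _]]].
- intros x. simpl. rewrite <- norm_sq_adjoint_comp. split; [|easy].
  apply pow2_ge_0.
- now exists P.
Qed.

Lemma op_abs_sq A x : op_abs A (op_abs A x) = adjoint A (A x).
Proof. exact (f_equal (fun S : BOp H => S x) (proj2 (op_abs_spec A))). Qed.

Lemma norm_sq_zero x : norm x ^ 2 = 0 -> x = zero.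
Proof. intros E. apply norm_eq_0. nra. Qed.

(** Here [D = A P - Q A] satisfies [Q D = - D P], so [D^* D] commutes with [P]
    and with its root [R]; then [D^* D P = R D^* D R] is both nonnegative and
    equal to [- D^* Q D], which is nonpositive. *)
Lemma positive_intertwine A P Q :
  positive P -> positive Q -> (forall x, A (P (P x)) = Q (Q (A x))) ->
  forall x, A (P x) = Q (A x).
Proof.
intros hP hQ hA.
assert (hPs := positive_self_adjoint P hP). assert (hQs := positive_self_adjoint Q hQ).
pose (D := minus (op_comp A P) (op_comp Q A) : BOp H).
assert (hDx : forall x, D x = minus (A (P x)) (Q (A x)))
  by (intros x; exact (op_minus_apply (op_comp A P) (op_comp Q A) x)).
assert (hQD : forall x y, inner (Q (D x)) y = (- inner (D (P x)) y)%C).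
{ intros x y. rewrite !hDx, op_sub, !inner_minus_l, hA. ring. }
pose (S := op_comp (adjoint D) D).
assert (hSD : forall x y, inner (S x) y = inner (D x) (D y))
  by (intros x y; apply adjoint_spec_l).
assert (hSP : forall x, S (P x) = P (S x)).
{ intros x. apply inner_ext. intros y.
  rewrite hSD, hPs, hSD, (inner_conj H (D (P y)) (D x)).
  replace (inner (D (P y)) (D x)) with (- inner (Q (D y)) (D x))%C by (rewrite hQD; ring).
  replace (inner (D (P x)) (D y)) with (- inner (Q (D x)) (D y))%C by (rewrite hQD; ring).
  rewrite Copp_conj, <- inner_conj, hQs. reflexivity. }
destruct (positive_sqrt_exists P hP) as [R [hR [hRP hRc]]].
assert (hRs := positive_self_adjoint R hR).
assert (hRR : forall x, R (R x) = P x)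
  by (intros x; exact (f_equal (fun S : BOp H => S x) hRP)).
assert (hDR : forall x, D (R x) = zero).
{ intros x. apply norm_sq_zero. apply Rle_antisym; [|apply pow2_ge_0].
  rewrite norm_sq, <- hSD, (hRc S hSP), hRs, hRR, <- hPs, <- hSP, hSD.
  replace (inner (D (P x)) (D x)) with (- inner (Q (D x)) (D x))%C by (rewrite hQD; ring).
  assert (h := proj1 (hQ (D x))). destruct (inner (Q (D x)) (D x)).
  unfold Re in *. simpl in *. lra. }
assert (hDP : forall x, D (P x) = zero) by (intros x; rewrite <- hRR; apply hDR).
(* In [D^* D = (P A^* - A^* Q) D] the term [Q D = - D P] now vanishes. So the range of [S] lies in
   that of [P], which [D] kills, and [D S = 0] forces [S = 0]. *)
assert (hSA : forall x, S x = P (adjoint A (D x))).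
{ intros x. apply inner_ext. intros y.
  rewrite hSD, (hDx y), inner_minus_r, <- hQs, hQD, hDP, inner_zero_l.
  rewrite hPs, adjoint_spec_l. ring. }
intros x. apply minus_zero_eq. rewrite <- hDx. apply norm_sq_zero.
assert (hS0 : S x = zero).
{ apply inner_self_zero. rewrite hSD, (hSA x), hDP. apply inner_zero_r. }
rewrite norm_sq, <- hSD, hS0, inner_zero_l. reflexivity.
Qed.

Lemma le_0_of_le_mult (D C : R) : (forall e, 0 < e -> D <= C * e) -> D <= 0.
Proof.
intros h. apply Rnot_lt_le. intros hD. assert (hC := Rabs_pos C).
assert (he : 0 < D / (2 * (Rabs C + 1))) by (apply Rdiv_lt_0_compat; lra).
specialize (h _ he).
assert (h1 : C * (D / (2 * (Rabs C + 1))) <= (Rabs C + 1) * (D / (2 * (Rabs C + 1)))).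
{ apply Rmult_le_compat_r; [lra|]. assert (h1 := Rle_abs C). lra. }
replace ((Rabs C + 1) * (D / (2 * (Rabs C + 1)))) with (D / 2) in h1 by (field; lra).
lra.
Qed.

(** The squares intertwine, both sides being [A A^* A]; [positive_intertwine] transfers this to the
    roots. *)
Lemma op_abs_intertwine A x : A (op_abs A x) = op_abs (adjoint A) (A x).
Proof.
revert x. apply positive_intertwine; [apply op_abs_spec..|].
intros x. now rewrite !op_abs_sq, adjoint_adjoint.
Qed.

Lemma op_abs_ker A x : op_abs A x = zero -> A x = zero.
Proof.
intros E. apply inner_self_zero.
rewrite <- adjoint_spec_l, <- op_abs_sq, E, op_0. apply inner_zero_l.
Qed.

(** For [x = |A| z] one has [A x = |A^*| A z], so Cauchy-Schwarz applies to the form of [|A^*|] at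
    [A z] and [y]; its value at [A z] is [<|A|x,x>]. *)
Lemma mixed_schwarz_range A z y :
  let x := op_abs A z in
  Cmod (inner (A x) y) ^ 2
    <= Re (inner (op_abs A x) x) * Re (inner (op_abs (adjoint A) y) y).
Proof.
simpl. rewrite op_abs_intertwine.
replace (inner (op_abs A (op_abs A z)) (op_abs A z))
  with (inner (op_abs (adjoint A) (A z)) (A z)).
- apply positive_cauchy_schwarz, op_abs_spec.
- rewrite <- op_abs_intertwine, adjoint_spec, <- op_abs_sq.
  symmetry. apply positive_self_adjoint, op_abs_spec.
Qed.

Lemma mixed_schwarz A x y :
  Cmod (inner (A x) y) ^ 2
    <= Re (inner (op_abs A x) x) * Re (inner (op_abs (adjoint A) y) y).
Proof.
set (P := op_abs A). set (q := Re (inner (op_abs (adjoint A) y) y)).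
assert (hP : positive P) by apply op_abs_spec.
assert (hPs := positive_self_adjoint P hP).
assert (hq : 0 <= q) by (apply (proj1 (op_abs_spec (adjoint A)))).
(* The root [R] of [|A|] writes [<|A|z,z>] as a squared norm, so the square-rooted inequality is
   between norm-continuous quantities and survives the limit to the closure. *)
destruct (positive_sqrt_exists P hP) as [R [hR [hRP _]]].
assert (hRs := positive_self_adjoint R hR).
assert (hRx : forall z, Re (inner (P z) z) = norm (R z) ^ 2).
{ intros z. rewrite norm_sq, <- hRs, <- hRP. reflexivity. }
assert (hran : forall z, Cmod (inner (A (P z)) y) <= sqrt q * norm (R (P z))).
{ intros z. assert (h := mixed_schwarz_range A z y). simpl in h. fold P q in h.
  rewrite hRx in h. assert (hs := sqrt_pos q). assert (hr := norm_ge_0 (R (P z))).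
  apply Rsqr_incr_0_var; [|now apply Rmult_le_pos]. rewrite !Rsqr_pow2, Rpow_mult_distr.
  rewrite pow2_sqrt by exact hq. lra. }
destruct (orthogonal_projection (fun l => exists z, l = P z) x) as [u [hu ho]].
{ exists zero. symmetry. apply op_0. }
{ intros v w [a ->] [b ->]. exists (plus a b). symmetry. apply op_add. }
{ intros c v [a ->]. exists (scal c a). symmetry. apply op_smul. }
assert (hPu : P (minus x u) = zero).
{ apply inner_ext. intros z. rewrite inner_zero_l, hPs. apply ho. now exists z. }
assert (hAu := op_abs_ker A _ hPu). rewrite op_sub in hAu. apply minus_zero_eq in hAu.
rewrite op_sub in hPu. apply minus_zero_eq in hPu.
assert (hle : Cmod (inner (A u) y) <= sqrt q * norm (R u)).
{ apply Rminus_le.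
  apply le_0_of_le_mult with (op_norm A * norm y + sqrt q * op_norm R). intros e he.
  destruct (hu e he) as [l [[z hz] hlu]]. specialize (hran z). rewrite <- hz in hran.
  assert (hs := sqrt_pos q). assert (hy := norm_ge_0 y).
  assert (h1 : Cmod (inner (A u) y) <= Cmod (inner (A l) y) + op_norm A * e * norm y).
  { replace (inner (A u) y) with (inner (A l) y - inner (A (minus l u)) y)%C
      by (rewrite op_sub, inner_minus_l; ring).
    apply Rle_trans with (1 := Cmod_triangle _ _). rewrite Cmod_opp.
    apply Rplus_le_compat_l. apply Rle_trans with (1 := cauchy_schwarz _ _).
    apply Rmult_le_compat_r; [exact hy|]. apply Rle_trans with (1 := op_norm_apply _ _).
    apply Rmult_le_compat_l; [apply op_norm_ge0|lra]. }
  assert (h2 : norm (R l) <= norm (R u) + op_norm R * e).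
  { rewrite <- (minus_plus_cancel (R l) (R u)).
    apply Rle_trans with (1 := norm_plus_le _ _). rewrite Rplus_comm.
    apply Rplus_le_compat_l. rewrite <- op_sub.
    apply Rle_trans with (1 := op_norm_apply _ _).
    apply Rmult_le_compat_l; [apply op_norm_ge0|lra]. }
  assert (h3 := Rmult_le_compat_l _ _ _ hs h2). lra. }
(* Since [A] and [|A|] both kill [x - u], either side of the claim is unchanged when [x] is replaced
   by [u]. *)
rewrite hAu.
replace (Re (inner (P x) x)) with (norm (R u) ^ 2)
  by (rewrite <- hRx, <- hPu, hPs, <- hPu, <- hPs; reflexivity).
rewrite Rmult_comm, <- (pow2_sqrt q), <- Rpow_mult_distr by exact hq.
apply pow_incr. split; [apply Cmod_ge_0|exact hle].
Qed.
End MixedSchwarz.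

(** * Norm and numerical radius estimates, and quadratic forms of squares *)

Section Bounds.
Context {H : HilbertSpace}.
Implicit Types x : H.
Implicit Types A B X : BOp H.

Lemma op_norm_comp A B : op_norm (op_comp A B) <= op_norm A * op_norm B.
Proof.
apply op_norm_le. intros x hx. apply Rle_trans with (1 := op_norm_apply A (B x)).
apply Rmult_le_compat_l; [apply op_norm_ge0|now apply op_norm_ub].
Qed.

Lemma op_norm_id_le : op_norm (op_id (H := H)) <= 1.
Proof. apply op_norm_le. auto. Qed.

Lemma Re_inner_le_op_norm A x : norm x = 1 -> Re (inner (A x) x) <= op_norm A.
Proof.
intros hx. assert (h1 := Rle_trans _ _ _ (Rle_abs _) (re_le_Cmod (inner (A x) x))).
assert (h2 := cauchy_schwarz (A x) x). assert (h3 := op_norm_apply A x).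
rewrite hx in *. lra.
Qed.

Lemma Cmod_inner_le_op_norm A x : norm x = 1 -> Cmod (inner (A x) x) <= op_norm A.
Proof.
intros hx. assert (h2 := cauchy_schwarz (A x) x). assert (h3 := op_norm_apply A x).
rewrite hx in *. lra.
Qed.

Lemma numerical_radius_ge0 A : 0 <= numerical_radius A.
Proof.
destruct (classic (exists x : H, norm x = 1)) as [[x hx]|hn].
- apply Rle_trans with (Cmod (inner (A x) x)); [apply Cmod_ge_0|].
  apply sup_ub with (op_norm A); [|now exists x].
  intros s [z [hz ->]]. now apply Cmod_inner_le_op_norm.
(* With no unit vector the set is empty, its least upper bound is [m_infty], and [real] turns that
   into 0. *)
- unfold numerical_radius, sup.
  rewrite (is_lub_Rbar_unique _ m_infty); [apply Rle_refl|].
  split; [|now intros b _; destruct b]. intros s [z [hz _]]. destruct hn. now exists z.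
Qed.

Lemma numerical_radius_le A M : 0 <= M ->
  (forall x, norm x = 1 -> Cmod (inner (A x) x) <= M) -> numerical_radius A <= M.
Proof.
intros hM h. destruct (classic (exists x : H, norm x = 1)) as [[x hx]|hn].
- apply sup_le; [now exists (Cmod (inner (A x) x)), x|]. intros s [z [hz ->]]. now apply h.
- unfold numerical_radius, sup.
  rewrite (is_lub_Rbar_unique _ m_infty); [exact hM|].
  split; [|now intros b _; destruct b]. intros s [z [hz _]]. destruct hn. now exists z.
Qed.

Lemma numerical_radius_sq_le A M : 0 <= M ->
  (forall x, norm x = 1 -> Cmod (inner (A x) x) ^ 2 <= M) -> numerical_radius A ^ 2 <= M.
Proof.
intros hM h. rewrite <- (pow2_sqrt M hM). apply pow_incr.
split; [apply numerical_radius_ge0|]. apply numerical_radius_le; [apply sqrt_pos|].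
intros x hx. rewrite <- (sqrt_pow2 (Cmod _) (Cmod_ge_0 _)). now apply sqrt_le_1_alt, h.
Qed.

Lemma self_adjoint_plus A B : self_adjoint A -> self_adjoint B -> self_adjoint (plus A B).
Proof.
intros hA hB x y. change (inner (plus (A x) (B x)) y = inner x (plus (A y) (B y))).
now rewrite inner_plus_l, inner_plus_r, hA, hB.
Qed.

Lemma self_adjoint_scal (a : R) A : self_adjoint A -> self_adjoint (scal a A).
Proof.
intros hA x y. change (inner (scal (RtoC a : C_AbsRing) (A x)) y
  = inner x (scal (RtoC a : C_AbsRing) (A y))).
rewrite inner_scal_l, inner_scal_r, hA. f_equal. unfold Cconj; simpl. now rewrite Ropp_0.
Qed.

Lemma self_adjoint_sqr A : self_adjoint A -> self_adjoint (op_sqr A).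
Proof. intros hA x y. simpl. now rewrite hA, hA. Qed.

Lemma Re_inner_plus A B x :
  Re (inner ((plus A B) x) x) = Re (inner (A x) x) + Re (inner (B x) x).
Proof.
change (Re (inner (plus (A x) (B x)) x) = Re (inner (A x) x) + Re (inner (B x) x)).
now rewrite inner_plus_l.
Qed.

Lemma Re_inner_scal (a : R) A x : Re (inner ((scal a A) x) x) = a * Re (inner (A x) x).
Proof.
change (Re (inner (scal (RtoC a : C_AbsRing) (A x)) x) = a * Re (inner (A x) x)).
rewrite inner_scal_l. unfold Re. simpl. ring.
Qed.

Lemma Re_inner_sqr A x : self_adjoint A -> Re (inner (op_sqr A x) x) = norm (A x) ^ 2.
Proof. intros hA. now rewrite norm_sq, <- hA. Qed.

Lemma Re_inner_sqr_ge A x : self_adjoint A -> norm x = 1 ->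
  Re (inner (A x) x) ^ 2 <= Re (inner (op_sqr A x) x).
Proof.
intros hA hx. rewrite Re_inner_sqr by exact hA.
assert (h1 := re_le_Cmod (inner (A x) x)).
assert (h2 := cauchy_schwarz (A x) x). rewrite hx in h2.
rewrite <- (pow2_abs (Re _)). apply pow_incr. split; [apply Rabs_pos|lra].
Qed.

(** * Closed form of the operator integral *)

Lemma is_RInt_scal_fixed (V : CompleteNormedModule R_AbsRing) (G g : R -> R) (v : V) a b :
  (forall t, is_derive G t (g t)) -> (forall t, continuous g t) ->
  is_RInt (fun t => scal (g t) v) a b (scal (G b - G a) v).
Proof.
intros hG hg.
replace (scal (G b - G a) v) with (minus (scal (G b) v) (scal (G a) v))
  by (symmetry; exact (scal_minus_distr_r (G b) (G a) v)).
apply (is_RInt_derive (fun t => scal (G t) v) (fun t => scal (g t) v)).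
- intros t _. exact (is_derive_scal_l G t (g t) v (hG t)).
- intros t _. apply (continuous_scal_l g v). apply hg.
Qed.

(** As [X] commutes with the identity, the square expands into fixed operators with coefficients
    [(1-t)^2], [2t(1-t)m] and [t^2 m^2]. Each of these polynomials in [t] contributes a factor 1/3
    on the unit interval. *)
Lemma is_RInt_sqr_segment X (m : R) :
  is_RInt (fun t : R => op_sqr (plus (scal (1 - t) X) (scal (t * m) op_id))) 0 1
    (plus (scal (/ 3) (op_sqr X)) (plus (scal (/ 3 * m) X) (scal (/ 3 * m ^ 2) op_id))).
Proof.
apply is_RInt_ext with (fun t : R => plus (scal ((1 - t) ^ 2) (op_sqr X))
  (plus (scal (2 * t * (1 - t) * m) X) (scal (t ^ 2 * m ^ 2) op_id))).
{ intros t _. apply op_ext. intros x.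
  change (op_plus (op_scal ((1 - t) ^ 2) (op_sqr X))
      (op_plus (op_scal (2 * t * (1 - t) * m) X) (op_scal (t ^ 2 * m ^ 2) op_id)) x =
    op_sqr (op_plus (op_scal (1 - t) X) (op_scal (t * m) op_id)) x).
  cbn [op_fun op_plus op_scal op_sqr op_comp op_id].
  rewrite op_add, !op_smul. apply inner_ext. intros z.
  rewrite !inner_plus_l, !inner_scal_l, !inner_plus_l, !inner_scal_l.
  rewrite !RtoC_mult, !RtoC_pow, !RtoC_minus. ring. }
apply (is_RInt_plus (V := BOp_NormedModule)); [|apply (is_RInt_plus (V := BOp_NormedModule))].
- replace (/ 3) with (- (1 - 1) ^ 3 / 3 - - (1 - 0) ^ 3 / 3) by field.
  apply (is_RInt_scal_fixed BOp_CompleteNormedModule (fun t => - (1 - t) ^ 3 / 3)).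
  + intros t. auto_derive; [easy|]. field.
  + intros t. apply (ex_derive_continuous (fun t => (1 - t) ^ 2)). auto_derive. easy.
- replace (/ 3 * m) with ((1 ^ 2 - 2 * 1 ^ 3 / 3) * m - (0 ^ 2 - 2 * 0 ^ 3 / 3) * m) by field.
  apply (is_RInt_scal_fixed BOp_CompleteNormedModule (fun t => (t ^ 2 - 2 * t ^ 3 / 3) * m)).
  + intros t. auto_derive; [easy|]. field.
  + intros t. apply (ex_derive_continuous (fun t => 2 * t * (1 - t) * m)). auto_derive. easy.
- replace (/ 3 * m ^ 2) with (1 ^ 3 / 3 * m ^ 2 - 0 ^ 3 / 3 * m ^ 2) by field.
  apply (is_RInt_scal_fixed BOp_CompleteNormedModule (fun t => t ^ 3 / 3 * m ^ 2)).
  + intros t. auto_derive; [easy|]. field.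
  + intros t. apply (ex_derive_continuous (fun t => t ^ 2 * m ^ 2)). auto_derive. easy.
Qed.

Lemma numerical_range_sq_le A (alpha : R) x : 0 <= alpha <= 1 -> norm x = 1 ->
  Cmod (inner (A x) x) ^ 2 <=
  Re (inner ((plus (scal alpha
           (op_sqr (scal (/ 2) (plus (op_abs A) (op_abs (adjoint A))))))
         (scal (1 - alpha) (op_sqr (op_abs (adjoint A)))) : BOp H) x) x).
Proof.
intros ha hx. set (P := op_abs A). set (Q := op_abs (adjoint A)).
assert (hP : positive P) by apply op_abs_spec.
assert (hQ : positive Q) by apply op_abs_spec.
assert (hPs := positive_self_adjoint P hP). assert (hQs := positive_self_adjoint Q hQ).
set (c := Cmod (inner (A x) x)).
assert (hG : self_adjoint (scal (/ 2) (plus P Q)))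
  by now apply self_adjoint_scal, self_adjoint_plus.
assert (h1 := Re_inner_sqr_ge _ x hG hx). rewrite Re_inner_scal, Re_inner_plus in h1.
assert (h2 := mixed_schwarz A x x). fold P Q c in h2.
(* The square of [|A^*|] is [A A^*], so the right side is the squared norm of [A^* x]. *)
assert (h3 : c ^ 2 <= Re (inner (op_sqr Q x) x)).
{ change (op_sqr Q x) with (Q (Q x)). unfold Q.
  rewrite op_abs_sq, adjoint_adjoint, adjoint_spec, <- norm_sq. unfold c.
  rewrite adjoint_spec. apply pow_incr. split; [apply Cmod_ge_0|].
  assert (h := cauchy_schwarz x (adjoint A x)). rewrite hx in h. lra. }
rewrite Re_inner_plus, !Re_inner_scal.
(* AM-GM for the two factors of the mixed Schwarz bound. *)
assert (h4 : c ^ 2 <= (/ 2 * (Re (inner (P x) x) + Re (inner (Q x) x))) ^ 2).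
{ assert (h := pow2_ge_0 (Re (inner (P x) x) - Re (inner (Q x) x))). lra. }
assert (h5 := Rle_trans _ _ _ h4 h1).
assert (h6 := Rmult_le_compat_l alpha _ _ (proj1 ha) h5).
assert (h7 := Rmult_le_compat_l (1 - alpha) _ _ ltac:(lra) h3). lra.
Qed.
End Bounds.

Theorem corollary3p10 (H : HilbertSpace) (A : BOp H) (alpha : R)
    (halpha : 0 <= alpha <= 1) :
  let X : BOp H :=
    plus (scal alpha
           (op_sqr (scal (/ 2) (plus (op_abs A) (op_abs (adjoint A))))))
         (scal (1 - alpha) (op_sqr (op_abs (adjoint A)))) in
  numerical_radius A ^ 2
    <= sqrt (op_norm
         (RInt (fun t : R =>
            op_sqr (plus (scal (1 - t) X)
                         (scal (t * numerical_radius A ^ 2) op_id))) 0 1))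
    <= op_norm X.
Proof.
intros X.
assert (hX : forall x : H, norm x = 1 -> Cmod (inner (A x) x) ^ 2 <= Re (inner (X x) x))
  by (intros x; now apply numerical_range_sq_le).
assert (hXs : self_adjoint X).
{ apply self_adjoint_plus; apply self_adjoint_scal, self_adjoint_sqr;
    [apply self_adjoint_scal, self_adjoint_plus|];
    apply positive_self_adjoint, op_abs_spec. }
set (m := numerical_radius A ^ 2). assert (hm : 0 <= m) by apply pow2_ge_0.
assert (hN0 := op_norm_ge0 X).
assert (hmX : m <= op_norm X).
{ apply numerical_radius_sq_le; [exact hN0|]. intros x hx.
  apply Rle_trans with (1 := hX x hx). now apply Re_inner_le_op_norm. }
clearbody X.
rewrite (is_RInt_unique (V := BOp_CompleteNormedModule) _ _ _ _ (is_RInt_sqr_segment X m)).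
set (V := plus (scal (/ 3) (op_sqr X))
  (plus (scal (/ 3 * m) X) (scal (/ 3 * m ^ 2) op_id)) : BOp H).
assert (hV0 := op_norm_ge0 V).
split.
- set (s := sqrt (op_norm V)). assert (hs0 : 0 <= s) by apply sqrt_pos.
  assert (hs : s ^ 2 = op_norm V) by now apply pow2_sqrt.
  (* The goal returns unchanged, but with [s < m] available. If some unit [x] had [c > s], then
     [c^2], [m c] and [m^2] would sum to more than [3 s^2], against the bound [h] on the form of
     [V]. *)
  apply Rnot_lt_le. intros hlt. apply (Rlt_not_le _ _ hlt).
  apply numerical_radius_sq_le; [exact hs0|]. intros x hx.
  assert (h : / 3 * Re (inner (op_sqr X x) x) + (/ 3 * m * Re (inner (X x) x)
      + / 3 * m ^ 2 * Re (inner (op_id x) x)) <= op_norm V)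
    by (rewrite <- !Re_inner_scal, <- !Re_inner_plus; exact (Re_inner_le_op_norm V x hx)).
  change (op_id x) with x in h. rewrite <- norm_sq, hx, <- hs in h.
  assert (h1 := Re_inner_sqr_ge X x hXs hx).
  specialize (hX x hx). set (c := Cmod (inner (A x) x) ^ 2) in *.
  apply Rnot_lt_le. intros hc.
  assert (hcs : s ^ 2 < c ^ 2) by nra.
  assert (hms : s ^ 2 < m ^ 2) by nra.
  assert (hcm : s ^ 2 <= m * c) by nra.
  assert (hcq : c ^ 2 <= Re (inner (X x) x) ^ 2) by (apply pow_incr; lra).
  assert (hmc := Rmult_le_compat_l m _ _ hm hX). lra.
- rewrite <- (sqrt_pow2 (op_norm X)) by exact hN0. apply sqrt_le_1_alt.
  (* The triangle inequality gives this middle value; by [m <= op_norm X] each of its three terms is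
     at most a third of [op_norm X ^ 2]. *)
  apply Rle_trans with (/ 3 * op_norm X ^ 2 + (/ 3 * m * op_norm X + / 3 * m ^ 2 * 1)).
  + assert (hsc : forall a (B : BOp H) b, 0 <= a -> op_norm B <= b ->
      op_norm (scal a B) <= a * b).
    { intros a B b h0 hb. apply Rle_trans with (1 := op_norm_scal a B).
      rewrite Rabs_pos_eq by exact h0. now apply Rmult_le_compat_l. }
    apply Rle_trans with (1 := op_norm_triangle _ _). apply Rplus_le_compat.
    { apply hsc; [lra|]. simpl. rewrite Rmult_1_r. apply op_norm_comp. }
    apply Rle_trans with (1 := op_norm_triangle _ _). apply Rplus_le_compat.
    { apply hsc; lra. }
    { apply hsc; [nra|]. apply op_norm_id_le. }
  + nra.
Qed.
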